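(* Let $H$ be a finite-dimensional unimodular Hopf algebra over a field $\Bbbk$. Then the extension $H\subseteq\mathrm{Drin}(H)$ is a central Frobenius extension.
   Context: All Hopf algebras are over $\Bbbk$ with invertible antipode $S$; $\Delta(h)=h_{(1)}\otimes h_{(2)}$, counit $\varepsilon$. A finite-dimensional Hopf algebra $H$ is unimodular if its spaces of left integrals ($x\Lambda=\varepsilon(x)\Lambda$ for all $x$) and right integrals ($\Lambda x=\varepsilon(x)\Lambda$ for all $x$) coincide. $\mathrm{Drin}(H)$ is the Drinfeld double: as a coalgebra $H^{*\mathrm{cop}}\otimes H$, i.e. $\Delta(f\otimes h)=(f_{(2)}\otimes h_{(1)})\otimes(f_{(1)}\otimes h_{(2)})$, with multiplication $(p\otimes a)(q\otimes b)=p\,q\big(S^{-1}(a_{(3)})(-)a_{(1)}\big)\otimes a_{(2)}b$; $H$ is the Hopf subalgebra $\varepsilon\otimes H$. A Hopf algebra extension $K\subset L$ (inclusion) is a Frobenius extension if $L$ is finitely generated projective over $K$ and there is a Frobenius morphism, i.e. a $K$-$K$-bimodule map $\mathrm{tr}\colon L\to K$ such that $L\to\mathrm{Hom}_K(L,K)$ (left $K$-linear maps), $l\mapsto\mathrm{tr}((-)l)$, is bijective. It is a central Frobenius extension if there is a Frobenius morphism which is a morphism of $L$-$L$-bicomodules, i.e. $l_{(1)}\otimes\mathrm{tr}(l_{(2)})\otimes l_{(3)}=\mathrm{tr}(l)_{(1)}\otimes\mathrm{tr}(l)_{(2)}\otimes\mathrm{tr}(l)_{(3)}$ in $L\otimes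 K\otimes L$ for all $l\in L$. *)

(* Defs.v *)
From HB Require Import structures.
From mathcomp Require Import all_boot all_order all_algebra all_field.

Set Implicit Arguments.
Unset Strict Implicit.
Unset Printing Implicit Defensive.

Import GRing.Theory VectorInternalTheory.
Local Open Scope ring_scope.

Section Lin.
Variable k : fieldType.

Definition lin (U V : lmodType k) (f : U -> V) :=
  forall a u v, f (a *: u + v) = a *: f u + f v.

Definition bilin (U V W : lmodType k) (f : U -> V -> W) :=
  (forall u, lin (f u)) /\ (forall v, lin (f^~ v)).

Implicit Types U V W : lmodType k.

Lemma lin0 U V (f : U -> V) : lin f -> f 0 = 0.
Proof.
move=> fl; have := fl 1 0 0; rewrite !scale1r addr0 => e.
by apply: (addIr (f 0)); rewrite add0r -e.
Qed.
Lemma linD U V (f : U -> V) : lin f -> {morph f : u v / u + v}.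
Proof. by move=> fl u v; have := fl 1 u v; rewrite !scale1r. Qed.
Lemma linZ U V (f : U -> V) : lin f -> forall a u, f (a *: u) = a *: f u.
Proof. by move=> fl a u; have := fl a u 0; rewrite !addr0 (lin0 fl) addr0. Qed.
Lemma lin_sum U V (f : U -> V) I r (P : pred I) F :
  lin f -> f (\sum_(i <- r | P i) F i) = \sum_(i <- r | P i) f (F i).
Proof. by move=> fl; apply: (big_morph f (linD fl) (lin0 fl)). Qed.

Lemma lin_id U : lin (fun u : U => u).
Proof. by []. Qed.
Lemma lin_linear U V W (g : {linear V -> W}) (f : U -> V) :
  lin f -> lin (fun u => g (f u)).
Proof. by move=> fl a u v; rewrite fl linearP. Qed.
Lemma lin_comp U V W (g : V -> W) (f : U -> V) :
  lin g -> lin f -> lin (fun u => g (f u)).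
Proof. by move=> gl fl a u v; rewrite fl gl. Qed.
Lemma lin_big U V I r (P : pred I) (F : I -> U -> V) :
  (forall i, lin (F i)) -> lin (fun u => \sum_(i <- r | P i) F i u).
Proof.
move=> Fl a u v; rewrite scaler_sumr -big_split; apply: eq_bigr => i _.
exact: Fl.
Qed.
Lemma lin_scale U V c (f : U -> V) : lin f -> lin (fun u => c *: f u).
Proof. by move=> fl a u v; rewrite fl scalerDr !scalerA mulrC. Qed.
Lemma lin_scalel U V (f : U -> k^o) (c : V) : lin f -> lin (fun u => (f u : k) *: c).
Proof. by move=> fl a u v; rewrite fl scalerDl scalerA. Qed.
Lemma lin_mull U (A : algType k) (f : U -> A) c : lin f -> lin (fun u => f u * c).
Proof. by move=> fl a u v; rewrite fl mulrDl scalerAl. Qed.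
Lemma lin_mulr U (A : algType k) (f : U -> A) c : lin f -> lin (fun u => c * f u).
Proof. by move=> fl a u v; rewrite fl mulrDr scalerAr. Qed.
Lemma lin_mullk U (f : U -> k^o) (c : k^o) : lin f -> lin (fun u => f u * c : k^o).
Proof. by move=> fl a u v; rewrite fl mulrDl -mulrA. Qed.
Lemma lin_mulrk U (f : U -> k^o) (c : k^o) : lin f -> lin (fun u => c * f u : k^o).
Proof. by move=> fl a u v; rewrite fl mulrDr mulrCA. Qed.
Lemma lin_lfun U (V W : vectType k) (F : U -> 'Hom(V, W)) x :
  lin F -> lin (fun u => F u x).
Proof. by move=> fl a u v; rewrite fl add_lfunE scale_lfunE. Qed.
End Lin.

Section Tens.
Variable k : fieldType.
Implicit Types (U V : vectType k) (W X : lmodType k).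

(* The tensor product, in the coordinates given by v2r: entry (i, j) is the
   coefficient of vb i *t vb j.  Its universal property is tlift_ten and
   tens_ext; no later definition looks at the entries. *)
Definition tens U V := 'M[k]_(dim U, dim V).
HB.instance Definition _ U V := Vector.on (tens U V).

Definition ten U V (u : U) (v : V) : tens U V :=
  \matrix_(i, j) (v2r u 0 i * v2r v 0 j).

Definition vb U (i : 'I_(dim U)) : U := r2v (delta_mx 0 i).

(* The linear map on U (x) V induced by f; only meaningful for bilinear f. *)
Definition tlift U V W (f : U -> V -> W) (t : tens U V) : W :=
  \sum_i \sum_j t i j *: f (vb i) (vb j).

Lemma vbE U (u : U) : u = \sum_i v2r u 0 i *: vb i.
Proof.
apply: v2r_inj; rewrite linear_sum [LHS]row_sum_delta; apply: eq_bigr => i _.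
by rewrite linearZ /= r2vK.
Qed.

Lemma v2r_vb U i j : v2r (vb (U := U) i) 0 j = (j == i)%:R.
Proof. by rewrite r2vK mxE eqxx. Qed.

Lemma tlift_lin U V W (f : U -> V -> W) : lin (tlift f).
Proof.
move=> a t t'; rewrite /tlift scaler_sumr -big_split; apply: eq_bigr => i _.
rewrite scaler_sumr -big_split; apply: eq_bigr => j _.
by rewrite !mxE scalerDl scalerA.
Qed.
HB.instance Definition _ U V W (f : U -> V -> W) :=
  GRing.isLinear.Build k (tens U V) W _ (tlift f) (tlift_lin f).

Lemma tlift_ten U V W (f : U -> V -> W) u v :
  bilin f -> tlift f (ten u v) = f u v.
Proof.
move=> [fl fr]; rewrite [in RHS](vbE u) (lin_sum _ _ _ (fr v)).
apply: eq_bigr => i _; rewrite (linZ (fr v)) [in RHS](vbE v).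
rewrite (lin_sum _ _ _ (fl _)) scaler_sumr; apply: eq_bigr => j _.
by rewrite (linZ (fl _)) !mxE scalerA.
Qed.

Lemma ten_linl U V (v : V) : lin (fun u : U => ten u v).
Proof. by move=> a u u'; apply/matrixP=> i j; rewrite !mxE linearP !mxE mulrDl mulrA. Qed.
Lemma ten_linr U V (u : U) : lin (fun v : V => ten u v).
Proof. by move=> a v v'; apply/matrixP=> i j; rewrite !mxE linearP !mxE mulrDr mulrCA. Qed.
Lemma ten_bilin U V : bilin (@ten U V).
Proof. by split=> ?; [exact: ten_linr | exact: ten_linl]. Qed.

Lemma tlift_tenE U V (t : tens U V) : tlift (@ten U V) t = t.
Proof.
apply/matrixP=> i j; rewrite summxE (bigD1 i) //= summxE (bigD1 j) //=.
rewrite !mxE !v2r_vb !eqxx !mulr1 !big1 ?addr0 //.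
- by move=> i' ne; rewrite summxE big1 // => j' _; rewrite !mxE !v2r_vb eq_sym (negPf ne) mul0r mulr0.
- by move=> j' ne; rewrite !mxE !v2r_vb [j == _]eq_sym (negPf ne) !mulr0.
Qed.

Lemma tlift_ext U V W (f g : U -> V -> W) t :
  (forall u v, f u v = g u v) -> tlift f t = tlift g t.
Proof. by move=> e; apply: eq_bigr => i _; apply: eq_bigr => j _; rewrite e. Qed.

Lemma tlift_comp U V W X (g : W -> X) (f : U -> V -> W) t :
  lin g -> g (tlift f t) = tlift (fun u v => g (f u v)) t.
Proof.
move=> gl; rewrite /tlift (lin_sum _ _ _ gl); apply: eq_bigr => i _.
by rewrite (lin_sum _ _ _ gl); apply: eq_bigr => j _; rewrite (linZ gl).
Qed.

Lemma tlift_exch U V (U' V' : vectType k) W (f : U -> V -> U' -> V' -> W) t t' :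
  tlift (fun u v => tlift (f u v) t') t =
  tlift (fun u' v' => tlift (fun u v => f u v u' v') t) t'.
Proof.
rewrite /tlift; under eq_bigr => i _ do under eq_bigr => j _ do
  (rewrite scaler_sumr; under eq_bigr => i' _ do rewrite scaler_sumr).
under [RHS]eq_bigr => i _ do under eq_bigr => j _ do
  (rewrite scaler_sumr; under eq_bigr => i' _ do rewrite scaler_sumr).
under eq_bigr => i _ do rewrite exchange_big.
rewrite exchange_big; apply: eq_bigr => i' _.
under eq_bigr => i _ do rewrite exchange_big.
rewrite exchange_big; apply: eq_bigr => j' _.
apply: eq_bigr => i _; apply: eq_bigr => j _.
by rewrite !scalerA mulrC.
Qed.

Lemma tens_ext U V W (f g : tens U V -> W) :
  lin f -> lin g -> (forall u v, f (ten u v) = g (ten u v)) -> f =1 g.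
Proof.
move=> fl gl e t; rewrite -(tlift_tenE t) (tlift_comp _ _ fl).
by rewrite (tlift_comp _ _ gl); apply: tlift_ext.
Qed.

Lemma tlift_lin_body U V W X (F : X -> U -> V -> W) t :
  (forall u v, lin (fun x => F x u v)) -> lin (fun x : X => tlift (F x) t).
Proof.
move=> Fl; apply: lin_big => i; apply: lin_big => j; exact: lin_scale.
Qed.

Lemma tlift_lin_arg U V W X (F : U -> V -> W) (g : X -> tens U V) :
  lin g -> lin (fun x : X => tlift F (g x)).
Proof. exact: lin_comp (tlift_lin F). Qed.

Lemma lin_tenl U V X (f : X -> U) (v : V) : lin f -> lin (fun x : X => ten (f x) v).
Proof. exact: lin_comp (ten_linl v). Qed.
Lemma lin_tenr U V X (f : X -> V) (u : U) : lin f -> lin (fun x : X => ten u (f x)).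
Proof. exact: lin_comp (ten_linr u). Qed.

Definition tmap U V (U' V' : vectType k) (f : U -> U') (g : V -> V') : tens U V -> tens U' V' :=
  tlift (fun u v => ten (f u) (g v)).

Definition tassoc U V (W : vectType k) : tens (tens U V) W -> tens U (tens V W) :=
  tlift (fun t w => tlift (fun u v => ten u (ten v w)) t).

End Tens.
Arguments ten {k U V} u v.
Notation "u *t v" := (ten u v) (at level 40, left associativity) : ring_scope.

Notation "\ten_ ( a , b <- t ) E" := (tlift (fun a b => E) t)
 (at level 41, E at level 41, a binder, b binder, t at level 10,
 format "'[' \ten_ ( a ,  b  <-  t ) '/  '  E ']'") : ring_scope.

Ltac lin_step := first
  [ exact: lin_id
  | assumption
  | apply: ten_linl | apply: ten_linr
  | apply: tlift_lin_body => ? ? /=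
  | apply: tlift_lin_arg
  | (match goal with |- lin (fun _ => \sum_(_ <- _ | _) _) => apply: lin_big => ? /= end)
  | apply: lin_tenl | apply: lin_tenr
  | apply: lin_mullk | apply: lin_mulrk
  | apply: lin_mull | apply: lin_mulr
  | apply: lin_scalel | apply: lin_scale
  | match goal with H : forall _ _ _, lin _ |- _ => refine (lin_comp (H _ _ _) _) end
  | match goal with H : forall _ _, lin _ |- _ => refine (lin_comp (H _ _) _) end
  | match goal with H : forall _, lin _ |- _ => refine (lin_comp (H _) _) end
  | match goal with H : lin _ |- _ => refine (lin_comp H _) end
  | apply: lin_linear
  | apply: lin_lfun ].
Ltac lin_tac := repeat (first [ progress intros | split | lin_step ]).

Ltac tens_ind t := move: t; match goal with |- forall t, @eq _ (@?F t) (@?G t) =>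
    apply: (tens_ext (f := F) (g := G)); [by lin_tac | by lin_tac |] end.

Section TensAlg.
Variables (k : fieldType) (A B : falgType k).

Definition tone : tens A B := 1 *t 1.
Definition tmul (s t : tens A B) : tens A B :=
  tlift (fun a b => tlift (fun a' b' => (a * a') *t (b * b')) t) s.

Lemma tmul_linl t : lin (tmul^~ t).
Proof. exact: tlift_lin. Qed.
Lemma tmul_linr s : lin (tmul s).
Proof. by rewrite /tmul; lin_tac. Qed.

Lemma tmul_ten a b a' b' : tmul (a *t b) (a' *t b') = (a * a') *t (b * b').
Proof. by rewrite /tmul !tlift_ten //; lin_tac. Qed.

Lemma tmulA : associative tmul.
Proof.
have Hl := tmul_linl; have Hr := tmul_linr.
move=> s t r; tens_ind s => a b; tens_ind t => c d; tens_ind r => e f.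
by rewrite !tmul_ten !mulrA.
Qed.
Lemma tmul1l : left_id tone tmul.
Proof.
have Hl := tmul_linl; have Hr := tmul_linr.
move=> s; tens_ind s => a b; by rewrite tmul_ten !mul1r.
Qed.
Lemma tmul1r : right_id tone tmul.
Proof.
have Hl := tmul_linl; have Hr := tmul_linr.
move=> s; tens_ind s => a b; by rewrite tmul_ten !mulr1.
Qed.
Lemma tmulDl : left_distributive tmul +%R.
Proof. by move=> s t r; rewrite (linD (tmul_linl r)). Qed.
Lemma tmulDr : right_distributive tmul +%R.
Proof. by move=> s t r; rewrite (linD (tmul_linr s)). Qed.
Lemma tone_neq0 : tone != 0.
Proof.
have nz (C : falgType k) : exists i, v2r (1 : C) 0 i != 0.
  apply/existsP; apply: contraNT (oner_neq0 C); rewrite negb_exists => /forallP z.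
  apply/eqP/v2r_inj/rowP => i; rewrite linear0 !mxE; apply/eqP.
  by have := z i; rewrite negbK.
have [i ni] := nz A; have [j nj] := nz B.
apply/eqP => /matrixP/(_ i j); rewrite !mxE => /eqP.
by rewrite mulf_eq0 (negPf ni) (negPf nj).
Qed.
HB.instance Definition _ := GRing.Zmodule_isNzRing.Build (tens A B)
  tmulA tmul1l tmul1r tmulDl tmulDr tone_neq0.
Lemma tscalAl a (s t : tens A B) : a *: (s * t) = (a *: s) * t.
Proof. by rewrite -(linZ (tmul_linl t)). Qed.
Lemma tscalAr a (s t : tens A B) : a *: (s * t) = s * (a *: t).
Proof. by rewrite -(linZ (tmul_linr s)). Qed.
HB.instance Definition _ := GRing.Lmodule_isLalgebra.Build k (tens A B) tscalAl.
HB.instance Definition _ := GRing.Lalgebra_isAlgebra.Build k (tens A B) tscalAr.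
HB.instance Definition _ := Algebra_isFalgebra.Build k (tens A B).

Lemma tenM (a a' : A) (b b' : B) : (a *t b) * (a' *t b') = (a * a') *t (b * b').
Proof. exact: tmul_ten. Qed.
End TensAlg.

HB.mixin Record Falgebra_isBialgebra (k : fieldType) H of Falgebra k H := {
  comul : {linear H -> tens H H};
  counit : {linear H -> k^o};
  comulA : forall h : H,
    tassoc (tmap comul idfun (comul h)) = tmap idfun comul (comul h);
  counitl : forall h : H, \ten_(x, y <- comul h) (counit x : k) *: y = h;
  counitr : forall h : H, \ten_(x, y <- comul h) (counit y : k) *: x = h;
  comulM : forall g h : H, comul (g * h) = comul g * comul h;
  comul1 : comul 1 = 1;
  counitM : forall g h : H, counit (g * h) = counit g * counit h;
  counit1 : counit 1 = 1
}.
#[short(type="bialgType")]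
HB.structure Definition Bialgebra (k : fieldType) :=
  { H of Falgebra_isBialgebra k H & Falgebra k H }.
Arguments comul {k s}. Arguments counit {k s}.

(* antipodeV is the inverse of the antipode. *)
HB.mixin Record Bialgebra_isHopf (k : fieldType) H of Bialgebra k H := {
  antipode : {linear H -> H};
  antipodeV : {linear H -> H};
  antipodel : forall h : H, \ten_(x, y <- comul h) antipode x * y = (counit h : k)%:A;
  antipoder : forall h : H, \ten_(x, y <- comul h) x * antipode y = (counit h : k)%:A;
  antipodeK : cancel antipode antipodeV;
  antipodeVK : cancel antipodeV antipode
}.
#[short(type="hopfType")]
HB.structure Definition Hopf (k : fieldType) :=
  { H of Bialgebra_isHopf k H & Bialgebra k H }.
Arguments antipode {k s}. Arguments antipodeV {k s}.

(* Sweedler sums: \sw_(a, b <- h) E is E with a, b for h_(1), h_(2), and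
   similarly with three factors, E being multilinear in them. *)
Notation "\sw_ ( a , b <- h ) E" := (tlift (fun a b => E) (comul h))
 (at level 41, E at level 41, a name, b name, h at level 10,
 format "'[' \sw_ ( a ,  b  <-  h ) '/  '  E ']'") : ring_scope.
Notation "\sw_ ( a , b , c <- h ) E" := (\sw_(a, r <- h) \sw_(b, c <- r) E)
 (at level 41, E at level 41, a name, b name, c name, h at level 10,
 format "'[' \sw_ ( a ,  b ,  c  <-  h ) '/  '  E ']'") : ring_scope.

Section BialgTheory.
Variables (k : fieldType) (H : bialgType k).
Implicit Types (W X : lmodType k) (g h : H).

Lemma sw_assoc W (f : H -> H -> H -> W) h :
  (forall b c, lin (fun a => f a b c)) -> (forall a c, lin (fun b => f a b c)) ->
  (forall a b, lin (f a b)) ->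
  \sw_(r, c <- h) \sw_(a, b <- r) f a b c = \sw_(a, b, c <- h) f a b c.
Proof.
move=> f1 f2 f3.
pose F := tlift (fun a => tlift (f a)) : tens H (tens H H) -> W.
have Fl : lin F by exact: tlift_lin.
have Ften a b c : F (a *t (b *t c)) = f a b c.
  by rewrite /F !tlift_ten //; lin_tac.
transitivity (F (tassoc (tmap comul idfun (comul h)))); last first.
  rewrite comulA /tmap tlift_comp //; apply: tlift_ext => a r.
  by rewrite /F tlift_ten //; lin_tac.
have Gl : lin (fun t => F (tassoc t)) by apply: (lin_comp Fl); exact: tlift_lin.
rewrite /tmap (tlift_comp _ _ Gl); apply: tlift_ext => r c; rewrite /tassoc.
rewrite tlift_ten; last by lin_tac.
by rewrite tlift_comp //; apply: tlift_ext => a b; rewrite Ften.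
Qed.

Lemma sw_counitl W (f : H -> W) h : lin f -> \sw_(a, b <- h) (counit a : k) *: f b = f h.
Proof.
move=> fl; rewrite -[in RHS](counitl h) tlift_comp //.
by apply: tlift_ext => a b; rewrite (linZ fl).
Qed.
Lemma sw_counitr W (f : H -> W) h : lin f -> \sw_(a, b <- h) (counit b : k) *: f a = f h.
Proof.
move=> fl; rewrite -[in RHS](counitr h) tlift_comp //.
by apply: tlift_ext => a b; rewrite (linZ fl).
Qed.
Lemma sw_mul W (f : H -> H -> W) g h : bilin f ->
  \sw_(a, b <- g * h) f a b = \sw_(a, b <- g) \sw_(c, d <- h) f (a * c) (b * d).
Proof.
move=> [f1 f2]; rewrite comulM {1}/GRing.mul /= /tmul tlift_comp; last by lin_tac.
apply: tlift_ext => a b; rewrite tlift_comp; last by lin_tac.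
by apply: tlift_ext => c d; rewrite tlift_ten.
Qed.
Lemma sw_1 W (f : H -> H -> W) : bilin f -> \sw_(a, b <- 1) f a b = f 1 1.
Proof. by move=> fb; rewrite comul1 tlift_ten. Qed.

Lemma sw_exch W (f : H -> H -> H -> H -> W) g h :
 \sw_(a, b <- g) \sw_(c, d <- h) f a b c d =
 \sw_(c, d <- h) \sw_(a, b <- g) f a b c d.
Proof. exact: tlift_exch. Qed.

Lemma swZ W (U V : vectType k) c (f : U -> V -> W) t : c *: tlift f t = tlift (fun a b => c *: f a b) t.
Proof. by rewrite (tlift_comp (g := fun x => c *: x)) //; lin_tac. Qed.

Lemma conv_uniq (A : algType k) (X Y Z : H -> A) :
  lin X -> lin Y -> lin Z ->
  (forall h, \sw_(a, b <- h) X a * Y b = (counit h : k)%:A) ->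
  (forall h, \sw_(a, b <- h) Y a * Z b = (counit h : k)%:A) ->
  X =1 Z.
Proof.
move=> Xl Yl Zl XY YZ h.
transitivity (\sw_(a, b, c <- h) X a * (Y b * Z c)).
  rewrite -[LHS](sw_counitr h Xl); apply: tlift_ext => a r.
  by rewrite -tlift_comp ?YZ -?scalerAr ?mulr1 //; lin_tac.
rewrite -sw_assoc; [|by lin_tac..].
rewrite -[RHS](sw_counitl h Zl); apply: tlift_ext => r c.
under tlift_ext => a b do rewrite mulrA.
by rewrite -(tlift_comp (g := fun x => x * Z c)) ?XY -?scalerAl ?mul1r //; lin_tac.
Qed.

Lemma conv_uniq2 (A : algType k) (X Y Z : H -> H -> A) :
  bilin X -> bilin Y -> bilin Z ->
  (forall g h, \sw_(a, b <- g) \sw_(u, v <- h) X a u * Y b v = ((counit g : k) * counit h)%:A) ->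
  (forall g h, \sw_(a, b <- g) \sw_(u, v <- h) Y a u * Z b v = ((counit g : k) * counit h)%:A) ->
  forall g h, X g h = Z g h.
Proof.
move=> [Xl Xr] [Yl Yr] [Zl Zr] XY YZ g h.
transitivity (\sw_(a, b, c <- g) \sw_(u, v, w <- h) X a u * (Y b v * Z c w)).
  rewrite -[LHS](sw_counitr g (Xr h)); apply: tlift_ext => a r.
  rewrite -[X a h](sw_counitr h (Xl a)) swZ tlift_exch; apply: tlift_ext => u t.
  transitivity (X a u * ((counit r : k) * counit t)%:A).
    by rewrite -scalerAr mulr1 scalerA.
  rewrite -YZ tlift_comp; last by lin_tac.
  by apply: tlift_ext => b c; rewrite tlift_comp //; lin_tac.
transitivity (\sw_(r, c <- g) \sw_(t, w <- h) \sw_(a, b <- r) \sw_(u, v <- t)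
     (X a u * Y b v) * Z c w).
  rewrite -sw_assoc; [|by lin_tac..]; apply: tlift_ext => r c.
  rewrite [RHS]tlift_exch; apply: tlift_ext => a b.
  rewrite -sw_assoc; [|by lin_tac..].
  by do 2!apply: tlift_ext => ? ?; rewrite mulrA.
apply: esym; rewrite -[LHS](sw_counitl g (Zr h)); apply: tlift_ext => r c.
rewrite -[Z c h](sw_counitl h (Zl c)) swZ; apply: tlift_ext => t w.
transitivity (((counit r : k) * counit t)%:A * Z c w).
  by rewrite -scalerAl mul1r scalerA.
rewrite -XY (tlift_comp (g := fun x => x * _)); last by lin_tac.
by apply: tlift_ext => a b; rewrite (tlift_comp (g := fun x => x * _)) //; lin_tac.
Qed.

Section Antipode.
Variable S : {linear H -> H}.
Hypothesis Sl : forall h, \sw_(a, b <- h) S a * b = (counit h : k)%:A.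
Hypothesis Sr : forall h, \sw_(a, b <- h) a * S b = (counit h : k)%:A.
Lemma conv_invM g h : S (g * h) = S h * S g.
Proof.
apply: esym; move: g h.
apply: (conv_uniq2 (Y := fun a b => a * b) (Z := fun g h => S (g * h))); try by lin_tac.
- move=> g h.
  transitivity (\sw_(u, v <- h) (S u * (counit g : k)%:A * v)).
    rewrite tlift_exch; apply: tlift_ext => u v.
    rewrite -Sl (tlift_comp (g := fun x => _ * x * _)); last by lin_tac.
    by apply: tlift_ext => a b; rewrite !mulrA.
  under tlift_ext => u v do rewrite -scalerAr mulr1 -scalerAl.
  by rewrite -swZ Sl scalerA.
- move=> g h.
  transitivity (\sw_(a, b <- g * h) a * S b).
    by rewrite sw_mul //; lin_tac.
  by rewrite Sr counitM.
Qed.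

Lemma conv_inv1 : S 1 = 1.
Proof.
have := Sl 1; rewrite sw_1; last by lin_tac.
by rewrite mulr1 counit1 scale1r.
Qed.
Variable T : {linear H -> H}.
Hypothesis Tl : forall h, \sw_(a, b <- h) T b * a = (counit h : k)%:A.
Lemma skew_antipodeVK : cancel T S.
Proof.
move=> h; apply: esym; move: h.
apply: (conv_uniq (X := fun h => h) (Y := S) (Z := fun h => S (T h))); try by lin_tac.
move=> h; rewrite -[RHS]mulr1 -scalerAl mul1r -conv_inv1 -linearZ /= -Tl tlift_comp; last by lin_tac.
by apply: tlift_ext => a b; rewrite conv_invM.
Qed.
Lemma skew_antipodeK : cancel S T.
Proof.
have Ti : lker (linfun T) == 0%VS.
  by apply/lker0P => u v; rewrite !lfunE /= => /(can_inj skew_antipodeVK).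
move=> h; have : h \in limg (linfun T).
  rewrite (_ : limg _ = fullv) ?memvf //; apply/eqP.
  have K0 : (fullv :&: lker (linfun T) = 0)%VS by rewrite (eqP Ti) capv0.
  by rewrite eqEdim subvf (limg_dim_eq K0) leqnn.
by case/memv_imgP => g _; rewrite lfunE /= => ->; rewrite skew_antipodeVK.
Qed.
End Antipode.
End BialgTheory.

Section HopfTheory.
Variables (k : fieldType) (H : hopfType k).
Implicit Types (W X : lmodType k) (g h : H).
Lemma sw_antipodel W (f : H -> W) h : lin f ->
  \sw_(a, b <- h) f (antipode a * b) = (counit h : k) *: f 1.
Proof. by move=> fl; rewrite -(linZ fl) -antipodel tlift_comp. Qed.
Lemma sw_antipoder W (f : H -> W) h : lin f ->
  \sw_(a, b <- h) f (a * antipode b) = (counit h : k) *: f 1.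
Proof. by move=> fl; rewrite -(linZ fl) -antipoder tlift_comp. Qed.

Lemma antipode1 : antipode (1 : H) = 1.
Proof. exact: conv_inv1 (@antipodel k H). Qed.
Lemma antipodeM g h : antipode (g * h) = antipode h * antipode g.
Proof. by apply: conv_invM; [exact: antipodel | exact: antipoder]. Qed.

Lemma antipode_comul h : comul (antipode h) = \sw_(a, b <- h) antipode b *t antipode a.
Proof.
move: h; apply: (conv_uniq (Y := fun h => comul h)); try by lin_tac.
- move=> {}h; transitivity (comul (\sw_(a, b <- h) antipode a * b)).
    by rewrite tlift_comp ?linear_lin; [apply: tlift_ext => a b; rewrite comulM | lin_tac].
  by rewrite antipodel linearZ /= comul1.
move=> h.
transitivity (\sw_(a, r <- h) \sw_(u, v <- a) \sw_(c, d <- r) (u * antipode d) *t (v * antipode c)).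
  apply: tlift_ext => a r; rewrite -[in LHS](tlift_tenE (comul a)).
  rewrite (tlift_comp (g := fun x => x * _)); last by lin_tac.
  apply: tlift_ext => u v; rewrite tlift_comp; last by lin_tac.
  by apply: tlift_ext => c d; rewrite tenM.
rewrite sw_assoc; [|by lin_tac..].
transitivity (\sw_(u, q <- h) (u * antipode q) *t (1 : H)); last first.
  by rewrite -(tlift_comp (g := fun x => x *t (1 : H))) ?antipoder; [rewrite (linZ (ten_linl _)) | lin_tac].
apply: tlift_ext => u q; rewrite -sw_assoc; [|by lin_tac..].
rewrite -(sw_counitl (f := fun q => (u * antipode q) *t 1)); last by lin_tac.
apply: tlift_ext => p d.
rewrite -(tlift_comp (g := fun x => _ *t x)); last by lin_tac.
by rewrite antipoder (linZ (ten_linr _)).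
Qed.

Lemma antipodeV1 : antipodeV (1 : H) = 1.
Proof. by rewrite -[1 in LHS]antipode1 antipodeK. Qed.
Lemma antipodeVM g h : antipodeV (g * h) = antipodeV h * antipodeV g.
Proof. by apply: (can_inj antipodeK); rewrite antipodeM !antipodeVK. Qed.
Lemma antipodeV_comul h : comul (antipodeV h) = \sw_(a, b <- h) antipodeV b *t antipodeV a.
Proof.
rewrite -{2}[h]antipodeVK antipode_comul tlift_comp; last exact: tlift_lin.
rewrite -[LHS]tlift_tenE; apply: tlift_ext => a b.
by rewrite tlift_ten ?antipodeK //; lin_tac.
Qed.
Lemma sw_antipodeV W (f : H -> H -> W) h : bilin f ->
  \sw_(a, b <- antipodeV h) f a b = \sw_(a, b <- h) f (antipodeV b) (antipodeV a).
Proof.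
move=> fb; rewrite antipodeV_comul (tlift_comp _ _ (tlift_lin f)).
by apply: tlift_ext => a b; rewrite tlift_ten.
Qed.
Lemma antipodeVr h : \sw_(a, b <- h) b * antipodeV a = (counit h : k)%:A.
Proof.
apply: (can_inj antipodeK); rewrite linearZ /= antipode1 -antipoder tlift_comp; last by lin_tac.
by apply: tlift_ext => a b; rewrite antipodeM antipodeVK.
Qed.
Lemma antipodeVl h : \sw_(a, b <- h) antipodeV b * a = (counit h : k)%:A.
Proof.
apply: (can_inj antipodeK); rewrite linearZ /= antipode1 -antipodel tlift_comp; last by lin_tac.
by apply: tlift_ext => a b; rewrite antipodeM antipodeVK.
Qed.
Lemma sw_antipodeVr W (f : H -> W) h : lin f ->
  \sw_(a, b <- h) f (b * antipodeV a) = (counit h : k) *: f 1.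
Proof. by move=> fl; rewrite -(linZ fl) -antipodeVr tlift_comp. Qed.
Lemma sw_antipodeVl W (f : H -> W) h : lin f ->
  \sw_(a, b <- h) f (antipodeV b * a) = (counit h : k) *: f 1.
Proof. by move=> fl; rewrite -(linZ fl) -antipodeVl tlift_comp. Qed.

(* f(S^-1(a_(3)) x a_(1), a_(2)), the exchange rule of the Drinfeld double. *)
Definition rsw W (f : H -> H -> W) (a x : H) : W :=
  \sw_(a1, a2, a3 <- a) f (antipodeV a3 * x * a1) a2.

Lemma rsw_lin W f a : (forall b, lin (fun y => f y b)) -> lin (rsw (W := W) f a).
Proof. by move=> fl; rewrite /rsw; lin_tac. Qed.
Lemma rsw_linl W f x : lin (fun a => rsw (W := W) f a x).
Proof. by rewrite /rsw; lin_tac. Qed.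

Lemma rsw_ext W (f g : H -> H -> W) a x : (forall y b, f y b = g y b) -> rsw f a x = rsw g a x.
Proof. by move=> e; apply: tlift_ext => ? ?; apply: tlift_ext => ? ?; apply: e. Qed.
Lemma rsw_comp W X (g : W -> X) (f : H -> H -> W) a x : lin g ->
  g (rsw f a x) = rsw (fun y b => g (f y b)) a x.
Proof.
move=> gl; rewrite /rsw tlift_comp //; apply: tlift_ext => ? ?.
by rewrite tlift_comp.
Qed.
Lemma rsw_mul W (f : H -> H -> W) a b x : bilin f ->
  rsw f (a * b) x = rsw (fun y c => rsw (fun z d => f z (c * d)) b y) a x.
Proof.
move=> [f1 f2]; rewrite /rsw sw_mul; last by lin_tac.
apply: tlift_ext => a1 r.
under tlift_ext => b1 s do (rewrite sw_mul; last by lin_tac).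
rewrite tlift_exch; apply: tlift_ext => a2 a3.
do 2!apply: tlift_ext => ? ?.
by rewrite antipodeVM !mulrA.
Qed.
Lemma rsw_1 W (f : H -> H -> W) x : bilin f -> rsw f 1 x = f x 1.
Proof.
by move=> [f1 f2]; rewrite /rsw !sw_1 ?antipodeV1 ?mul1r ?mulr1 //; lin_tac.
Qed.

Lemma counit_antipodeV h : counit (antipodeV h) = counit h.
Proof.
have := congr1 counit (antipodeVl h); rewrite linearZ /= counit1.
rewrite tlift_comp; last by lin_tac.
rewrite -[_ *: 1]/(_ * 1) mulr1 => <-.
rewrite -[LHS](sw_counitl (f := fun h => counit (antipodeV h))); last by lin_tac.
by apply: tlift_ext => a b; rewrite counitM mulrC.
Qed.

Lemma rsw_dist W (f : H -> H -> H -> W) a x :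
  (forall b c, lin (fun a => f a b c)) -> (forall a c, lin (fun b => f a b c)) ->
  (forall a b, lin (f a b)) ->
  \sw_(x1, x2 <- x) rsw (fun y1 c => rsw (fun y2 d => f y1 y2 d) c x2) a x1 =
  rsw (fun y c => \sw_(y1, y2 <- y) f y1 y2 c) a x.
Proof.
move=> f1 f2 f3.
transitivity (\sw_(x1, x2 <- x) \sw_(a1, q <- a) \sw_(b1, t <- q) \sw_(b2, w <- t)
   \sw_(b3, a3 <- w) f (antipodeV a3 * x1 * a1) (antipodeV b3 * x2 * b1) b2).
  apply: tlift_ext => x1 x2; apply: tlift_ext => a1 q.
  rewrite /rsw sw_assoc; [|by lin_tac..].
  apply: tlift_ext => b1 t; rewrite sw_assoc //; by lin_tac.
apply: esym; rewrite /rsw.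
transitivity (\sw_(a1, a2, a3 <- a) \sw_(c, d <- a1) \sw_(u, v <- a3) 
  \sw_(x1, x2 <- x) f (antipodeV v * x1 * c) (antipodeV u * x2 * d) a2).
  apply: tlift_ext => a1 q; apply: tlift_ext => a2 a3.
  rewrite sw_mul; last by lin_tac.
  rewrite tlift_exch; apply: tlift_ext => c d.
  rewrite sw_mul; last by lin_tac.
  by rewrite sw_antipodeV //; lin_tac.
under tlift_ext => a1 q do rewrite tlift_exch.
rewrite sw_assoc; [|by lin_tac..].
rewrite [RHS]tlift_exch; apply: tlift_ext => c q.
rewrite [RHS]tlift_exch; apply: tlift_ext => d r.
rewrite [RHS]tlift_exch; apply: tlift_ext => a2 a3.
by rewrite [RHS]tlift_exch.
Qed.

Lemma rsw_comul W (f : H -> H -> H -> W) c x y :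
  (forall b c, lin (fun a => f a b c)) -> (forall a c, lin (fun b => f a b c)) ->
  (forall a b, lin (f a b)) ->
  \sw_(a, a' <- c) rsw (fun u b => rsw (fun v b' => f (v * u) b b') a' y) a x =
  rsw (fun w b => \sw_(b1, b2 <- b) f w b1 b2) c (y * x).
Proof.
move=> f1 f2 f3; rewrite /rsw.
rewrite sw_assoc; [|by lin_tac..]; apply: tlift_ext => a1 r.
rewrite sw_assoc; [|by lin_tac..].
rewrite sw_assoc; [|by lin_tac..]; apply: tlift_ext => a2 s.
rewrite -sw_assoc; [|by lin_tac..].
rewrite -[RHS](sw_counitl (f := fun s => \sw_(d2, d3 <- s) f (antipodeV d3 * (y * x) * a1) a2 d2)); last by lin_tac.
apply: tlift_ext => p t; rewrite swZ tlift_exch; apply: tlift_ext => d2 d3.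
have -> : antipodeV d3 * (y * x) * a1 = antipodeV d3 * y * 1 * (x * a1).
  by rewrite mulr1 !mulrA.
rewrite -(sw_antipodeVr (f := fun z => f (antipodeV d3 * y * z * (x * a1)) a2 d2)).
  by apply: tlift_ext => u v; rewrite !mulrA.
by lin_tac.
Qed.

Lemma rsw_counit W (f : H -> W) a : lin f ->
  rsw (fun y b => (counit b : k) *: f y) a 1 = (counit a : k) *: f 1.
Proof.
move=> fl; rewrite /rsw -sw_antipodeVl //; apply: tlift_ext => a1 r.
rewrite (sw_counitl (f := fun r => f (antipodeV r * 1 * a1))) ?mulr1 //.
by lin_tac.
Qed.

Lemma rsw_counity W (f : H -> W) a x : lin f ->
  rsw (fun y b => (counit y : k) *: f b) a x = (counit x : k) *: f a.
Proof.
move=> fl; rewrite /rsw.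
transitivity (\sw_(a1, r <- a) (counit a1 : k) *: \sw_(a2, a3 <- r) (counit a3 : k) *: ((counit x : k) *: f a2)).
  apply: tlift_ext => a1 r; rewrite swZ; apply: tlift_ext => a2 a3.
  rewrite !counitM counit_antipodeV !scalerA; congr (_ *: _).
  by rewrite [LHS]mulrC mulrA.
rewrite (sw_counitl (f := fun r => \sw_(a2, a3 <- r) (counit a3 : k) *: ((counit x : k) *: f a2))); last by lin_tac.
by rewrite (sw_counitr (f := fun a2 => (counit x : k) *: f a2)) //; lin_tac.
Qed.

End HopfTheory.

Section LinLfun.
Variables (k : fieldType) (U V : vectType k).
Lemma lin_lfunE (f : U -> V) x : lin f -> linfun f x = f x.
Proof.
move=> fl.
pose fL := HB.pack_for {linear U -> V} f (GRing.isLinear.Build k U V _ f fl).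
exact: (lfunE fL).
Qed.
Lemma lin_linfun (X : lmodType k) (F : X -> U -> V) :
  (forall x, lin (F x)) -> (forall u, lin (F^~ u)) -> lin (fun x => linfun (F x)).
Proof.
move=> F1 F2 a x y; apply/lfunP => u.
by rewrite add_lfunE scale_lfunE !lin_lfunE // F2.
Qed.
Lemma lin_linfun_comp (Y X : lmodType k) (F : X -> U -> V) (g : Y -> X) :
  (forall x, lin (F x)) -> (forall u, lin (F^~ u)) -> lin g -> lin (fun x => linfun (F (g x))).
Proof. by move=> F1 F2 gl; apply: (lin_comp (lin_linfun F1 F2)). Qed.
End LinLfun.

Section Dual.
Variables (k : fieldType) (H : hopfType k).
Definition hdual := 'Hom(H, k^o).
HB.instance Definition _ := Vector.on hdual.
Implicit Types (p q : hdual) (x y a b c h : H).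

Lemma dual_linl x : lin (fun p : hdual => p x : k^o).
Proof. by move=> a p q; rewrite add_lfunE scale_lfunE. Qed.
Lemma dual_linr p : lin (p : H -> k^o).
Proof. by move=> a x y; rewrite linearP. Qed.

Definition conv p q : hdual := linfun (fun x => \sw_(x1, x2 <- x) (p x1 * q x2) : k^o).
Lemma convE p q x : conv p q x = \sw_(x1, x2 <- x) (p x1 * q x2).
Proof. by rewrite lin_lfunE //; lin_tac. Qed.
Definition dual_one : hdual := linfun counit.
Lemma dual_oneE x : dual_one x = counit x.
Proof. exact: lfunE. Qed.
(* q(S^-1(c) (-) a) *)
Definition twist q a c : hdual := linfun (fun x => q (antipodeV c * x * a)).
Lemma twistE q a c x : twist q a c x = q (antipodeV c * x * a).
Proof. by rewrite lin_lfunE //; lin_tac. Qed.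

Lemma conv_linl q : lin (conv^~ q).
Proof.
move=> a p p'; apply/lfunP => x; rewrite add_lfunE scale_lfunE !convE.
by move: a p p'; change (lin (fun p : hdual => \sw_(x1, x2 <- x) (p x1 * q x2) : k^o)); lin_tac.
Qed.
Lemma conv_linr p : lin (conv p).
Proof.
move=> a q q'; apply/lfunP => x; rewrite add_lfunE scale_lfunE !convE.
by move: a q q'; change (lin (fun q : hdual => \sw_(x1, x2 <- x) (p x1 * q x2) : k^o)); lin_tac.
Qed.
Lemma twist_lin1 a c : lin (fun q => twist q a c).
Proof. by move=> b q q'; apply/lfunP => x; rewrite add_lfunE scale_lfunE !twistE add_lfunE scale_lfunE. Qed.
Lemma twist_lin2 q c : lin (fun a => twist q a c).
Proof. by move=> b a a'; apply/lfunP => x; rewrite add_lfunE scale_lfunE !twistE mulrDr -scalerAr linearP. Qed.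
Lemma twist_lin3 q a : lin (fun c => twist q a c).
Proof. by move=> b c c'; apply/lfunP => x; rewrite add_lfunE scale_lfunE !twistE linearP mulrDl mulrDl -!scalerAl linearP. Qed.

Definition dbasis (i : 'I_(dim H)) : hdual := linfun (fun x => v2r x 0 i : k^o).
(* Dual to the product of H: q_(1)(x) q_(2)(y) = q(x y), see dual_comulE. *)
Definition dual_comul q : tens hdual hdual :=
  \sum_i \sum_j (q (vb i * vb j) : k) *: (dbasis i *t dbasis j).
Lemma dbasisE i x : dbasis i x = v2r x 0 i.
Proof. by rewrite lin_lfunE // => a u v; rewrite linearP !mxE. Qed.
Lemma dual_comul_lin : lin dual_comul.
Proof.
apply: lin_big => i; apply: lin_big => j; apply: lin_scalel; exact: dual_linl.
Qed.
Lemma dual_comulE q x y : tlift (fun q1 q2 : hdual => q1 x * q2 y : k^o) (dual_comul q) = q (x * y).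
Proof.
pose f := fun q1 q2 : hdual => (q1 x * q2 y : k^o).
have fb : bilin f by rewrite /f; lin_tac.
have fl : lin (tlift f) by exact: tlift_lin.
rewrite -/f /dual_comul (lin_sum _ _ _ fl) [in RHS](vbE x) mulr_suml linear_sum.
apply: eq_bigr => i _; rewrite (lin_sum _ _ _ fl) [in RHS](vbE y) mulr_sumr linear_sum.
apply: eq_bigr => j _; rewrite (linZ fl) tlift_ten // /f !dbasisE.
rewrite -scalerAl -scalerAr !linearZ /= /GRing.scale /=.
by congr (_ * _); rewrite mulrC.
Qed.

(* The Drinfeld double, H^*cop (x) H as a coalgebra. *)
Definition drin := tens hdual H.
HB.instance Definition _ := Vector.on drin.
Implicit Types F G K : drin.

Definition drin_mul F G : drin :=
  \ten_(p, a <- F) \ten_(q, b <- G) \sw_(a1, a2, a3 <- a)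
     conv p (twist q a1 a3) *t (a2 * b).
Definition drin_one : drin := dual_one *t 1.
Definition drin_comul F : tens drin drin :=
  \ten_(p, a <- F) \ten_(p1, p2 <- dual_comul p) \sw_(a1, a2 <- a)
     (p2 *t a1) *t (p1 *t a2).
Definition drin_counit F : k^o := \ten_(p : hdual, a <- F) p 1 * counit a.
(* S(p (x) a) = (eps (x) S a) (p o S^-1 (x) 1), and likewise for S^-1. *)
Definition drin_antipode F : drin :=
  \ten_(p : hdual, a <- F) drin_mul (dual_one *t antipode a) (linfun (fun x => p (antipodeV x)) *t 1).
Definition drin_antipodeV F : drin :=
  \ten_(p : hdual, a <- F) drin_mul (dual_one *t antipodeV a) (linfun (fun x => p (antipode x)) *t 1).

(* Elements of H^* (x) H are determined by contracting H^* with all x : H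
   (ev_sep, sep_inj); identities in the double are checked this way. *)
Definition ev x F : H := \ten_(p : hdual, a <- F) (p x : k) *: a.
Lemma ev_lin x : lin (ev x). Proof. exact: tlift_lin. Qed.
Lemma ev_linx F : lin (ev^~ F). Proof. rewrite /ev; by lin_tac. Qed.
Lemma ev_ten x p a : ev x (p *t a) = (p x : k) *: a.
Proof. by rewrite /ev tlift_ten //; lin_tac. Qed.

Lemma drin_mul_ten p a q b : drin_mul (p *t a) (q *t b) =
  \sw_(a1, a2, a3 <- a) conv p (twist q a1 a3) *t (a2 * b).
Proof.
have C1 := conv_linl; have C2 := conv_linr.
have T1 := twist_lin1; have T2 := twist_lin2; have T3 := twist_lin3.
rewrite /drin_mul tlift_ten; last by lin_tac.
by rewrite tlift_ten //; lin_tac.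
Qed.

Lemma drin_mul_linl G : lin (drin_mul^~ G).
Proof. exact: tlift_lin. Qed.
Lemma drin_mul_linr F : lin (drin_mul F).
Proof. by rewrite /drin_mul; lin_tac. Qed.

Lemma ev_mul x F G : ev x (drin_mul F G) =
  \sw_(x1, x2 <- x) rsw (fun y b => b * ev y G) (ev x1 F) x2.
Proof.
have E1 := ev_lin; have E2 := ev_linx; have M1 := drin_mul_linl; have M2 := drin_mul_linr.
have R1 := rsw_linl.
rewrite /rsw; tens_ind F => p a; tens_ind G => q b.
rewrite drin_mul_ten tlift_comp //.
transitivity (\sw_(a1, a2, a3 <- a) \sw_(x1, x2 <- x) (p x1 * q (antipodeV a3 * x2 * a1) : k) *: (a2 * b)).
  apply: tlift_ext => a1 r; rewrite tlift_comp //; apply: tlift_ext => a2 a3.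
  rewrite ev_ten convE (tlift_comp (g := fun c : k^o => (c : k) *: (a2 * b))); last by lin_tac.
  by apply: tlift_ext => x1 x2; rewrite twistE.
under tlift_ext => a1 r do rewrite tlift_exch.
rewrite tlift_exch; apply: tlift_ext => x1 x2.
rewrite ev_ten [comul (_ *: _)]linearZ (linZ (tlift_lin _)) swZ; apply: tlift_ext => a1 r.
rewrite swZ; apply: tlift_ext => a2 a3.
by rewrite ev_ten -scalerAr scalerA.
Qed.

Lemma dual_exp p : \sum_i (p (vb i) : k) *: dbasis i = p.
Proof.
apply/lfunP => x; rewrite sum_lfunE [in RHS](vbE x) linear_sum.
by apply: eq_bigr => i _; rewrite scale_lfunE dbasisE linearZ /= /GRing.scale /= mulrC.
Qed.

Lemma drin_exp F : \sum_i (dbasis i *t ev (vb i) F) = F.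
Proof.
have E1 := ev_lin.
tens_ind F => p a; rewrite -[in RHS](dual_exp p) (lin_sum _ _ _ (ten_linl a)).
apply: eq_bigr => i _; rewrite ev_ten (linZ (ten_linl a)).
by rewrite (linZ (ten_linr _)).
Qed.

Definition sepfam (U U' : vectType k) (I : Type) (f : I -> U -> U') :=
  (forall i, lin (f i)) /\
  exists (J : finType) (c : J -> I) (r : J -> U' -> U),
    (forall j, lin (r j)) /\ forall u, \sum_j r j (f (c j) u) = u.
Lemma sep_inj (U U' : vectType k) (I : Type) (f : I -> U -> U') u v :
  sepfam f -> (forall i, f i u = f i v) -> u = v.
Proof.
by move=> [_ [J [c [r [_ e]]]]] h; rewrite -(e u) -(e v); apply: eq_bigr => j _; rewrite h.
Qed.
Lemma sep_tens (U U' V V' : vectType k) (I J : Type) (f : I -> U -> U') (g : J -> V -> V') :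
  sepfam f -> sepfam g -> sepfam (fun ij => tmap (f ij.1) (g ij.2)).
Proof.
move=> [fl [If [cf [rf [rfl ef]]]]] [gl [Ig [cg [rg [rgl eg]]]]].
split=> [[i j]|]; first exact: tlift_lin.
exists (If * Ig)%type, (fun ij => (cf ij.1, cg ij.2)), (fun ij => tmap (rf ij.1) (rg ij.2)).
split=> [[i j]|]; first exact: tlift_lin.
rewrite /tmap /= => T; move: (gl) (fl) (rfl) (rgl) => _ _ _ _; tens_ind T => u v.
rewrite -(pair_bigA _ (fun i j => tlift (fun u v => rf i u *t rg j v) (tlift (fun u v => f (cf i) u *t g (cg j) v) (u *t v)))) /=.
rewrite -[in RHS](ef u) (lin_sum _ _ _ (ten_linl v)); apply: eq_bigr => i _.
rewrite -[in RHS](eg v) (lin_sum _ _ _ (ten_linr _)); apply: eq_bigr => j _.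
by rewrite !tlift_ten //; lin_tac.
Qed.

Lemma ev_sep : sepfam ev.
Proof.
split; first exact: ev_lin.
exists 'I_(dim H), (fun i => vb i), (fun i a => dbasis i *t a); split => [j|F].
  exact: ten_linr.
exact: drin_exp.
Qed.

Lemma ev_one x : ev x drin_one = (counit x : k)%:A.
Proof. by rewrite ev_ten dual_oneE. Qed.

Definition ev2 xy := tmap (ev xy.1) (ev xy.2).
Lemma ev2_sep : sepfam ev2. Proof. exact: sep_tens ev_sep ev_sep. Qed.
Definition ev3 xyz := tmap (ev xyz.1) (ev2 xyz.2).
Lemma ev3_sep : sepfam ev3. Proof. exact: sep_tens ev_sep ev2_sep. Qed.

Lemma drin_mulA : associative drin_mul.
Proof.
have E1 := ev_lin; have E2 := ev_linx; have M1 := drin_mul_linl; have M2 := drin_mul_linr.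
have R1 := rsw_linl.
move=> F G K; apply: (sep_inj ev_sep) => x.
rewrite !ev_mul.
transitivity (\sw_(x1, r <- x) \sw_(x2, x3 <- r) rsw (fun y1 c => rsw (fun y2 d => 
    d * rsw (fun y b => b * ev y K) (ev y1 G) y2) c x3) (ev x1 F) x2).
  apply: tlift_ext => x1 r; rewrite rsw_dist; [|by rewrite /rsw; lin_tac..].
  apply: tlift_ext => ? ?; apply: tlift_ext => ? ?.
  rewrite ev_mul tlift_comp //; by lin_tac.
rewrite -sw_assoc; [|by rewrite /rsw; lin_tac..].
apply: tlift_ext => r x3; rewrite ev_mul.
rewrite (tlift_comp (g := fun a => rsw (fun y b => b * ev y K) a x3)); last exact: rsw_linl.
apply: tlift_ext => x1 x2.
rewrite [RHS](rsw_comp (g := fun a => rsw (fun y b => b * ev y K) a x3)); last exact: rsw_linl.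
apply: rsw_ext => y c; rewrite rsw_mul; last by lin_tac.
apply: rsw_ext => z d; rewrite (rsw_comp (g := fun a => d * a)); last by lin_tac.
by apply: rsw_ext => w b; rewrite mulrA.
Qed.

Lemma drin_mul1l : left_id drin_one drin_mul.
Proof.
have E1 := ev_lin; have E2 := ev_linx.
move=> F; apply: (sep_inj ev_sep) => x; rewrite ev_mul.
rewrite -[RHS](sw_counitl (f := fun x => ev x F)) //; apply: tlift_ext => x1 x2.
rewrite ev_one (linZ (rsw_linl _ _)) rsw_1 ?mul1r //; by lin_tac.
Qed.
Lemma drin_mul1r : right_id drin_one drin_mul.
Proof.
have E1 := ev_lin; have E2 := ev_linx.
move=> F; apply: (sep_inj ev_sep) => x; rewrite ev_mul.
rewrite -[RHS](sw_counitr (f := fun x => ev x F)) //; apply: tlift_ext => x1 x2.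
rewrite -(rsw_counity (f := fun b => b)) //; apply: rsw_ext => y b.
by rewrite ev_one -scalerAr mulr1.
Qed.
Lemma drin_mulDl : left_distributive drin_mul +%R.
Proof. by move=> s t r; rewrite (linD (drin_mul_linl r)). Qed.
Lemma drin_mulDr : right_distributive drin_mul +%R.
Proof. by move=> s t r; rewrite (linD (drin_mul_linr s)). Qed.
Lemma drin_one_neq0 : drin_one != 0.
Proof.
apply/eqP => /(congr1 (ev 1)); rewrite ev_one (lin0 (ev_lin 1)) counit1 scale1r.
by apply/eqP; exact: oner_neq0.
Qed.
HB.instance Definition _ := GRing.Zmodule_isNzRing.Build drin
  drin_mulA drin_mul1l drin_mul1r drin_mulDl drin_mulDr drin_one_neq0.
Lemma dscalAl (a : k) F G : a *: (F * G) = (a *: F) * G.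
Proof. by rewrite -(linZ (drin_mul_linl G)). Qed.
Lemma dscalAr (a : k) F G : a *: (F * G) = F * (a *: G).
Proof. by rewrite -(linZ (drin_mul_linr F)). Qed.
HB.instance Definition _ := GRing.Lmodule_isLalgebra.Build k drin dscalAl.
HB.instance Definition _ := GRing.Lalgebra_isAlgebra.Build k drin dscalAr.
HB.instance Definition _ := Algebra_isFalgebra.Build k drin.

Lemma drin_comul_lin : lin drin_comul. Proof. exact: tlift_lin. Qed.
Lemma drin_counit_lin : lin drin_counit. Proof. exact: tlift_lin. Qed.
Lemma drin_comul_ten p a : drin_comul (p *t a) = 
   \ten_(p1, p2 <- dual_comul p) \sw_(a1, a2 <- a) (p2 *t a1) *t (p1 *t a2).
Proof.
have := dual_comul_lin => dl; rewrite /drin_comul tlift_ten //; by lin_tac.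
Qed.
Lemma drin_counit_ten p a : drin_counit (p *t a) = p 1 * counit a.
Proof. by rewrite /drin_counit tlift_ten //; lin_tac. Qed.

Lemma ev2_comul xy F : ev2 xy (drin_comul F) = comul (ev (xy.2 * xy.1) F).
Proof.
case: xy => x y /=; have D := drin_comul_lin; have E := ev_lin.
have T : lin (ev2 (x, y)) by exact: tlift_lin.
tens_ind F => p a; rewrite drin_comul_ten (tlift_comp _ _ T) ev_ten.
rewrite linearZ /= -dual_comulE (tlift_comp (g := fun c : k^o => (c : k) *: comul a)); last by lin_tac.
apply: tlift_ext => p1 p2; rewrite (tlift_comp _ _ T) -[comul a in RHS]tlift_tenE swZ.
apply: tlift_ext => a1 a2; rewrite /ev2 /tmap tlift_ten; last by lin_tac.
by rewrite !ev_ten (linZ (ten_linr _)) (linZ (ten_linl _)) scalerA.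
Qed.

Lemma drin_counitE F : drin_counit F = counit (ev 1 F).
Proof.
have D := drin_counit_lin; have E := ev_lin.
tens_ind F => p a; by rewrite drin_counit_ten ev_ten linearZ.
Qed.

HB.instance Definition _ := GRing.isLinear.Build k drin (tens drin drin) _ drin_comul drin_comul_lin.
HB.instance Definition _ := GRing.isLinear.Build k drin k^o _ drin_counit drin_counit_lin.

Lemma ev2_lin xy : lin (ev2 xy). Proof. exact: tlift_lin. Qed.
Lemma ev2_ten xy F G : ev2 xy (F *t G) = ev xy.1 F *t ev xy.2 G.
Proof. have E := ev_lin; by rewrite /ev2 /tmap tlift_ten //; lin_tac. Qed.
Lemma ev3_lin xyz : lin (ev3 xyz). Proof. exact: tlift_lin. Qed.
Lemma ev3_ten xyz F T : ev3 xyz (F *t T) = ev xyz.1 F *t ev2 xyz.2 T.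
Proof. have E := ev_lin; have E2 := ev2_lin; by rewrite /ev3 /tmap tlift_ten //; lin_tac. Qed.

Lemma tassoc_lin (U V W : vectType k) : lin (@tassoc k U V W).
Proof. exact: tlift_lin. Qed.
Lemma tassoc_ten (U V W : vectType k) (u : U) (v : V) (w : W) :
  tassoc ((u *t v) *t w) = u *t (v *t w).
Proof. by rewrite /tassoc !tlift_ten //; lin_tac. Qed.

Lemma drin_comulA F :
  tassoc (tmap drin_comul idfun (drin_comul F)) = tmap idfun drin_comul (drin_comul F).
Proof.
have E := ev_lin; have E2 := ev2_lin; have E3 := ev3_lin; have D := drin_comul_lin.
apply: (sep_inj ev3_sep) => -[x [y z]].
have e1 (t : tens drin drin) G :
    ev3 (x, (y, z)) (tassoc (t *t G)) = tassoc (ev2 (x, y) t *t ev z G).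
  have As := tassoc_lin; tens_ind t => F1 F2.
  by rewrite tassoc_ten ev3_ten !ev2_ten tassoc_ten.
have e2 (t : tens drin drin) : ev3 (x, (y, z)) (tassoc (tmap drin_comul idfun t)) =
    tassoc (tmap comul idfun (ev2 (y * x, z) t)).
  have As := tassoc_lin; rewrite /tmap; tens_ind t => F1 F2.
  rewrite tlift_ten; last by lin_tac.
  rewrite e1 ev2_ten tlift_ten; last by lin_tac.
  by rewrite ev2_comul.
have e3 (t : tens drin drin) : ev3 (x, (y, z)) (tmap idfun drin_comul t) =
    tmap idfun comul (ev2 (x, z * y) t).
  rewrite /tmap; tens_ind t => F1 F2.
  rewrite tlift_ten; last by lin_tac.
  rewrite ev3_ten ev2_ten tlift_ten; last by lin_tac.
  by rewrite ev2_comul.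
by rewrite e2 e3 !ev2_comul /= comulA mulrA.
Qed.

Lemma drin_counitl F : tlift (fun X Y => (drin_counit X : k) *: Y) (drin_comul F) = F.
Proof.
have E := ev_lin; have E2 := ev2_lin.
apply: (sep_inj ev_sep) => x.
have e (t : tens drin drin) : ev x (tlift (fun X Y : drin => (drin_counit X : k) *: Y) t) =
    tlift (fun a b : H => (counit a : k) *: b) (ev2 (1, x) t).
  tens_ind t => F1 F2.
  rewrite tlift_ten; last by lin_tac.
  rewrite ev2_ten tlift_ten; last by lin_tac.
  by rewrite (linZ (E _)) drin_counitE.
by rewrite e ev2_comul counitl /= mulr1.
Qed.
Lemma drin_counitr F : tlift (fun X Y => (drin_counit Y : k) *: X) (drin_comul F) = F.
Proof.
have E := ev_lin; have E2 := ev2_lin.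
apply: (sep_inj ev_sep) => x.
have e (t : tens drin drin) : ev x (tlift (fun X Y : drin => (drin_counit Y : k) *: X) t) =
    tlift (fun a b : H => (counit b : k) *: a) (ev2 (x, 1) t).
  tens_ind t => F1 F2.
  rewrite tlift_ten; last by lin_tac.
  rewrite ev2_ten tlift_ten; last by lin_tac.
  by rewrite (linZ (E _)) drin_counitE.
by rewrite e ev2_comul counitr /= mul1r.
Qed.

Lemma ev2_mul xy (T T' : tens drin drin) : ev2 xy (T * T') =
  \sw_(x1, x2 <- xy.1) \sw_(y1, y2 <- xy.2)
    tlift (fun a a' => rsw (fun u b => rsw (fun v b' => (b *t b') * ev2 (u, v) T') a' y2) a x2)
      (ev2 (x1, y1) T).
Proof.
case: xy => x y /=.
have E := ev_lin; have E2 := ev2_lin; have EX := ev_linx.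
have M1 (t : tens drin drin) : lin (fun s => s * t) by lin_tac.
have M2 (s : tens drin drin) : lin (fun t => s * t) by lin_tac.
rewrite /rsw; tens_ind T => F F'.
tens_ind T' => G G'.
rewrite tenM ev2_ten /= !ev_mul (tlift_comp (g := fun s => s *t _)); last by lin_tac.
apply: tlift_ext => x1 x2; rewrite tlift_comp; last by lin_tac.
apply: tlift_ext => y1 y2; rewrite ev2_ten tlift_ten /=; last first.
  by rewrite /ev2 /tmap; lin_tac.
rewrite (rsw_comp (g := fun s => s *t _)); last by lin_tac.
apply: tlift_ext => ? ?; apply: tlift_ext => ? ?.
rewrite (rsw_comp (g := fun s => _ *t s)); last by lin_tac.
apply: tlift_ext => ? ?; apply: tlift_ext => ? ?.
by rewrite ev2_ten tenM.
Qed.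

Lemma drin_comulM F G : drin_comul (F * G) = drin_comul F * drin_comul G.
Proof.
have E := ev_lin; have EX := ev_linx.
apply: (sep_inj ev2_sep) => -[x y]; rewrite ev2_mul ev2_comul /=.
rewrite -[F * G]/(drin_mul F G) ev_mul tlift_comp; last by lin_tac.
rewrite sw_mul; last by rewrite /rsw; lin_tac.
rewrite tlift_exch; apply: tlift_ext => x1 x2; apply: tlift_ext => y1 y2.
rewrite ev2_comul /= rsw_comp; last by lin_tac.
transitivity (rsw (fun w b => \sw_(b1, b2 <- b) (b1 *t b2) * comul (ev w G)) (ev (y1 * x1) F) (y2 * x2)).
  apply: rsw_ext => w b; rewrite comulM -{1}(tlift_tenE (comul b)).
  by rewrite (tlift_comp (g := fun s => s * _)) //; lin_tac.
rewrite -rsw_comul; [|by lin_tac..].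
apply: tlift_ext => a a'; apply: rsw_ext => u b; apply: rsw_ext => v b'.
by rewrite ev2_comul.
Qed.

Lemma drin_comul1 : drin_comul 1 = 1.
Proof.
apply: (sep_inj ev2_sep) => -[x y]; rewrite ev2_comul /= ev2_ten /= !ev_one.
rewrite linearZ /= comul1 counitM (linZ (ten_linl _)) (linZ (ten_linr _)) scalerA.
by rewrite mulrC.
Qed.
Lemma drin_counitM F G : drin_counit (F * G) = drin_counit F * drin_counit G.
Proof.
have E := ev_lin; have EX := ev_linx.
rewrite !drin_counitE -[F * G]/(drin_mul F G) ev_mul sw_1; last by rewrite /rsw; lin_tac.
rewrite rsw_comp; last by lin_tac.
rewrite -[RHS](rsw_counit (f := fun y => counit (ev y G))); last by lin_tac.
by apply: rsw_ext => y b; rewrite counitM.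
Qed.
Lemma drin_counit1 : drin_counit 1 = 1.
Proof. by rewrite drin_counitE ev_one linearZ /= !counit1 /GRing.scale /= mulr1. Qed.

HB.instance Definition _ := Falgebra_isBialgebra.Build k drin
  drin_comulA drin_counitl drin_counitr drin_comulM drin_comul1 drin_counitM drin_counit1.

Definition drin_incl a : drin := dual_one *t a.
Definition drin_dual p : drin := p *t 1.
Lemma drin_incl_lin : lin drin_incl. Proof. exact: ten_linr. Qed.
Lemma drin_dual_lin : lin drin_dual. Proof. exact: ten_linl. Qed.
Lemma ev_drin_incl x a G : ev x (drin_incl a * G) = rsw (fun y b => b * ev y G) a x.
Proof.
have EX := ev_linx.
rewrite -[_ * _]/(drin_mul _ _) ev_mul.
rewrite -[RHS](sw_counitl (f := fun x => rsw (fun y b => b * ev y G) a x)); last first.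
  by rewrite /rsw; lin_tac.
by apply: tlift_ext => x1 x2; rewrite ev_ten dual_oneE (linZ (rsw_linl _ _)).
Qed.
Lemma ev_drin_dual x p G : ev x (drin_dual p * G) = \sw_(x1, x2 <- x) (p x1 : k) *: ev x2 G.
Proof.
have EX := ev_linx.
rewrite -[_ * _]/(drin_mul _ _) ev_mul; apply: tlift_ext => x1 x2.
by rewrite ev_ten (linZ (rsw_linl _ _)) rsw_1 ?mul1r //; lin_tac.
Qed.
Lemma drin_incl1 : drin_incl 1 = 1. Proof. by []. Qed.
Lemma drin_inclM a b : drin_incl (a * b) = drin_incl a * drin_incl b.
Proof.
apply: (sep_inj ev_sep) => x; rewrite ev_drin_incl ev_ten.
rewrite dual_oneE -(rsw_counity (f := fun c => c * b)); last by lin_tac.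
by apply: rsw_ext => y c; rewrite ev_ten dual_oneE scalerAr.
Qed.
Lemma drin_dualM p q : drin_dual (conv p q) = drin_dual p * drin_dual q.
Proof.
apply: (sep_inj ev_sep) => x; rewrite ev_drin_dual ev_ten convE.
rewrite (tlift_comp (g := fun c : k^o => (c : k) *: _)); last by lin_tac.
by apply: tlift_ext => x1 x2; rewrite ev_ten scalerA.
Qed.
Lemma drin_dual_incl p a : drin_dual p * drin_incl a = p *t a.
Proof.
apply: (sep_inj ev_sep) => x; rewrite ev_drin_dual ev_ten.
rewrite -[RHS](sw_counitr (f := fun x => (p x : k) *: a)); last by lin_tac.
by apply: tlift_ext => x1 x2; rewrite ev_ten dual_oneE scalerA mulrC -scalerA.
Qed.
Lemma drin_dual1 : drin_dual dual_one = 1. Proof. by []. Qed.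

Definition precomp (s : {linear H -> H}) p : hdual := linfun (fun x => p (s x)).
Lemma precompE s p x : precomp s p x = p (s x).
Proof. by rewrite lin_lfunE //; lin_tac. Qed.
Lemma precomp_lin s : lin (precomp s).
Proof. by move=> b q q'; apply/lfunP => x; rewrite add_lfunE scale_lfunE !precompE add_lfunE scale_lfunE. Qed.

Lemma drin_antipode_ten p a : drin_antipode (p *t a) = drin_incl (antipode a) * drin_dual (precomp antipodeV p).
Proof.
have := precomp_lin antipodeV; have := drin_dual_lin; have := drin_incl_lin => P1 P2 P3.
rewrite /drin_antipode tlift_ten //.
change (bilin (fun p a => drin_incl (antipode a) * drin_dual (precomp antipodeV p))); split=> [q|b].
  by apply: lin_mull; apply: (lin_comp P1); lin_tac.
by apply: lin_mulr; apply: (lin_comp P2).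
Qed.
Lemma drin_antipodeV_ten p a : drin_antipodeV (p *t a) = drin_incl (antipodeV a) * drin_dual (precomp antipode p).
Proof.
have := precomp_lin antipode; have := drin_dual_lin; have := drin_incl_lin => P1 P2 P3.
rewrite /drin_antipodeV tlift_ten //.
change (bilin (fun p a => drin_incl (antipodeV a) * drin_dual (precomp antipode p))); split=> [q|b].
  by apply: lin_mull; apply: (lin_comp P1); lin_tac.
by apply: lin_mulr; apply: (lin_comp P2).
Qed.

Lemma drin_antipode_lin : lin drin_antipode. Proof. exact: tlift_lin. Qed.
Lemma drin_antipodeV_lin : lin drin_antipodeV. Proof. exact: tlift_lin. Qed.
HB.instance Definition _ := GRing.isLinear.Build k drin drin _ drin_antipode drin_antipode_lin.
HB.instance Definition _ := GRing.isLinear.Build k drin drin _ drin_antipodeV drin_antipodeV_lin.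

Lemma conv1 p : tlift (fun p1 p2 => conv (precomp antipodeV p2) p1) (dual_comul p) = (p 1 : k) *: dual_one.
Proof.
apply/lfunP => x; rewrite scale_lfunE dual_oneE.
rewrite (tlift_comp (g := fun q : hdual => q x)); last exact: dual_linl.
transitivity (\sw_(a, b <- x) (p (b * antipodeV a)) : k^o).
  under tlift_ext => p1 p2 do rewrite convE.
  rewrite tlift_exch; apply: tlift_ext => a b.
  by rewrite -dual_comulE; apply: tlift_ext => p1 p2; rewrite precompE mulrC.
by rewrite (sw_antipodeVr (f := p)) /GRing.scale /= 1?mulrC //; lin_tac.
Qed.
Lemma conv2 p : tlift (fun p1 p2 => conv p2 (precomp antipodeV p1)) (dual_comul p) = (p 1 : k) *: dual_one.
Proof.
apply/lfunP => x; rewrite scale_lfunE dual_oneE.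
rewrite (tlift_comp (g := fun q : hdual => q x)); last exact: dual_linl.
transitivity (\sw_(a, b <- x) (p (antipodeV b * a)) : k^o).
  under tlift_ext => p1 p2 do rewrite convE.
  rewrite tlift_exch; apply: tlift_ext => a b.
  by rewrite -dual_comulE; apply: tlift_ext => p1 p2; rewrite precompE mulrC.
by rewrite (sw_antipodeVl (f := p)) /GRing.scale /= 1?mulrC //; lin_tac.
Qed.
Lemma conv3 p : tlift (fun p1 p2 => conv (precomp antipode p1) p2) (dual_comul p) = (p 1 : k) *: dual_one.
Proof.
apply/lfunP => x; rewrite scale_lfunE dual_oneE.
rewrite (tlift_comp (g := fun q : hdual => q x)); last exact: dual_linl.
transitivity (\sw_(a, b <- x) (p (antipode a * b)) : k^o).
  under tlift_ext => p1 p2 do rewrite convE.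
  rewrite tlift_exch; apply: tlift_ext => a b.
  by rewrite -dual_comulE; apply: tlift_ext => p1 p2; rewrite precompE.
by rewrite (sw_antipodel (f := p)) /GRing.scale /= 1?mulrC //; lin_tac.
Qed.

Lemma drin_antipodel F : tlift (fun X Y => drin_antipode X * Y) (drin_comul F) = (drin_counit F : k)%:A.
Proof.
have C1 := conv_linl; have C2 := conv_linr; have JH := drin_incl_lin; have JD := drin_dual_lin.
have D := drin_comul_lin; have C := drin_counit_lin; have A := drin_antipode_lin.
pose f (X Y : drin) := drin_antipode X * Y; have fl : lin (tlift f) by exact: tlift_lin.
rewrite -/f; tens_ind F => p a; rewrite drin_comul_ten drin_counit_ten (tlift_comp _ _ fl).
transitivity (\sw_(a1, a2 <- a) drin_incl (antipode a1) *
   drin_dual (tlift (fun p1 p2 => conv (precomp antipodeV p2) p1) (dual_comul p)) * drin_incl a2).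
  under tlift_ext => p1 p2 do rewrite (tlift_comp _ _ fl).
  rewrite tlift_exch; apply: tlift_ext => a1 a2.
  rewrite (tlift_comp (g := fun X => drin_incl (antipode a1) * drin_dual X * drin_incl a2)); last by lin_tac.
  apply: tlift_ext => p1 p2; rewrite tlift_ten; last by rewrite /f; lin_tac.
  by rewrite /f drin_antipode_ten drin_dualM -(drin_dual_incl p1) !mulrA.
rewrite conv1 (linZ JD) drin_dual1.
transitivity ((p 1 : k) *: drin_incl (\sw_(a1, a2 <- a) antipode a1 * a2)).
  rewrite (tlift_comp _ _ JH) swZ; apply: tlift_ext => a1 a2.
  by rewrite -scalerAr mulr1 -scalerAl drin_inclM.
by rewrite antipodel (linZ JH) drin_incl1 scalerA.
Qed.

Lemma drin_antipoder F : tlift (fun X Y => X * drin_antipode Y) (drin_comul F) = (drin_counit F : k)%:A.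
Proof.
have C1 := conv_linl; have C2 := conv_linr; have JH := drin_incl_lin; have JD := drin_dual_lin.
have D := drin_comul_lin; have C := drin_counit_lin; have A := drin_antipode_lin.
pose f (X Y : drin) := X * drin_antipode Y; have fl : lin (tlift f) by exact: tlift_lin.
rewrite -/f; tens_ind F => p a; rewrite drin_comul_ten drin_counit_ten (tlift_comp _ _ fl).
transitivity (tlift (fun p1 p2 => drin_dual p2 *
   drin_incl (\sw_(a1, a2 <- a) a1 * antipode a2) * drin_dual (precomp antipodeV p1)) (dual_comul p)).
  apply: tlift_ext => p1 p2; rewrite (tlift_comp _ _ fl).
  rewrite (tlift_comp (g := fun X => drin_dual p2 * drin_incl X * drin_dual (precomp antipodeV p1))); last by lin_tac.
  apply: tlift_ext => a1 a2; rewrite tlift_ten; last by rewrite /f; lin_tac.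
  by rewrite /f drin_antipode_ten drin_inclM -(drin_dual_incl p2) !mulrA.
rewrite antipoder (linZ JH) drin_incl1.
transitivity ((counit a : k) *: drin_dual (tlift (fun p1 p2 => conv p2 (precomp antipodeV p1)) (dual_comul p))).
  rewrite (tlift_comp _ _ JD) swZ; apply: tlift_ext => p1 p2.
  by rewrite drin_dualM -scalerAr mulr1 -scalerAl.
by rewrite conv2 (linZ JD) drin_dual1 scalerA mulrC.
Qed.
Lemma drin_antipodeVl F : tlift (fun X Y => drin_antipodeV Y * X) (drin_comul F) = (drin_counit F : k)%:A.
Proof.
have C1 := conv_linl; have C2 := conv_linr; have JH := drin_incl_lin; have JD := drin_dual_lin.
have D := drin_comul_lin; have C := drin_counit_lin; have A := drin_antipodeV_lin.
pose f (X Y : drin) := drin_antipodeV Y * X; have fl : lin (tlift f) by exact: tlift_lin.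
rewrite -/f; tens_ind F => p a; rewrite drin_comul_ten drin_counit_ten (tlift_comp _ _ fl).
transitivity (\sw_(a1, a2 <- a) drin_incl (antipodeV a2) *
   drin_dual (tlift (fun p1 p2 => conv (precomp antipode p1) p2) (dual_comul p)) * drin_incl a1).
  under tlift_ext => p1 p2 do rewrite (tlift_comp _ _ fl).
  rewrite tlift_exch; apply: tlift_ext => a1 a2.
  rewrite (tlift_comp (g := fun X => drin_incl (antipodeV a2) * drin_dual X * drin_incl a1)); last by lin_tac.
  apply: tlift_ext => p1 p2; rewrite tlift_ten; last by rewrite /f; lin_tac.
  by rewrite /f drin_antipodeV_ten drin_dualM -(drin_dual_incl p2) !mulrA.
rewrite conv3 (linZ JD) drin_dual1.
transitivity ((p 1 : k) *: drin_incl (\sw_(a1, a2 <- a) antipodeV a2 * a1)).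
  rewrite (tlift_comp _ _ JH) swZ; apply: tlift_ext => a1 a2.
  by rewrite -scalerAr mulr1 -scalerAl drin_inclM.
by rewrite antipodeVl (linZ JH) drin_incl1 scalerA.
Qed.
HB.instance Definition _ := Bialgebra_isHopf.Build k drin
  drin_antipodel drin_antipoder (skew_antipodeK drin_antipodel drin_antipoder drin_antipodeVl)
  (skew_antipodeVK drin_antipodel drin_antipoder drin_antipodeVl).
End Dual.

Section DrinIncl.
Variables (k : fieldType) (H : hopfType k).

Lemma drin_incl_monoid_morphism : monoid_morphism (@drin_incl k H).
Proof. by split; [exact: drin_incl1 | exact: drin_inclM]. Qed.
HB.instance Definition _ :=
  GRing.isLinear.Build k H (drin H) _ (@drin_incl k H) (@drin_incl_lin k H).
HB.instance Definition _ :=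
  GRing.isMonoidMorphism.Build H (drin H) (@drin_incl k H)
    drin_incl_monoid_morphism.

Lemma drin_incl_inj : injective (@drin_incl k H).
Proof.
move=> a b /(congr1 (ev 1)).
by rewrite !ev_ten dual_oneE counit1 !scale1r.
Qed.
Lemma drin_incl_comul (a : H) :
  comul (drin_incl a) = tmap (@drin_incl k H) (@drin_incl k H) (comul a).
Proof.
have L := @drin_incl_lin k H.
apply: (sep_inj (@ev2_sep k H)) => -[x y].
rewrite -[comul (drin_incl a)]/(drin_comul (drin_incl a)) ev2_comul ev_ten /=.
rewrite dual_oneE /tmap tlift_comp ?linearZ /=; last exact: ev2_lin.
rewrite -{1}[comul a]tlift_tenE swZ.
apply: tlift_ext => a1 a2; rewrite ev2_ten !ev_ten !dual_oneE.
by rewrite (linZ (ten_linl _)) (linZ (ten_linr _)) scalerA counitM mulrC.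
Qed.
Lemma drin_incl_counit (a : H) : counit (drin_incl a) = counit a.
Proof.
change (@drin_counit k H (@drin_incl k H a) = counit a); rewrite drin_counit_ten.
by rewrite dual_oneE counit1 mul1r.
Qed.
End DrinIncl.

Definition left_integral (k : fieldType) (H : hopfType k) (L : H) :=
  forall x : H, x * L = (counit x : k) *: L.
Definition right_integral (k : fieldType) (H : hopfType k) (L : H) :=
  forall x : H, L * x = (counit x : k) *: L.
Definition unimodular (k : fieldType) (H : hopfType k) :=
  forall L : H, left_integral L <-> right_integral L.

Record hopf_extension (k : fieldType) (K L : hopfType k) := HopfExtension {
  incl :> {lrmorphism K -> L};
  incl_inj : injective incl;
  incl_comul : forall a, comul (incl a) = tmap incl incl (comul a);
  incl_counit : forall a, counit (incl a) = counit a
}.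

Definition drin_extension (k : fieldType) (H : hopfType k) :
    hopf_extension H (drin H) :=
  @HopfExtension k H (drin H) (@drin_incl k H)
    (@drin_incl_inj k H) (@drin_incl_comul k H) (@drin_incl_counit k H).

(* L as a left K-module, K acting by left multiplication through incl. *)
Definition restr (k : fieldType) (K L : hopfType k)
  (i : hopf_extension K L) : Type := L.

Section Restr.
Variables (k : fieldType) (K L : hopfType k) (i : hopf_extension K L).
HB.instance Definition _ := GRing.Zmodule.on (restr i).
Definition restr_scale (a : K) (l : restr i) : restr i := i a * (l : L).
Lemma restr_scaleA a b l : restr_scale a (restr_scale b l) = restr_scale (a * b) l.
Proof. by rewrite /restr_scale rmorphM mulrA. Qed.
Lemma restr_scale1 : left_id 1 restr_scale.
Proof. by move=> l; rewrite /restr_scale rmorph1 mul1r. Qed.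
Lemma restr_scaleDr : right_distributive restr_scale +%R.
Proof. by move=> a l m; exact: mulrDr. Qed.
Lemma restr_scaleDl l : {morph restr_scale^~ l : a b / a + b}.
Proof. by move=> a b; rewrite /restr_scale rmorphD mulrDl. Qed.
HB.instance Definition _ := GRing.Zmodule_isLmodule.Build K (restr i)
  restr_scaleA restr_scale1 restr_scaleDr restr_scaleDl.
End Restr.

(* M is a direct summand of a free left module of finite rank. *)
Definition fg_projective (R : nzRingType) (M : lmodType R) :=
  exists (n : nat) (s : {linear M -> 'rV[R]_n}) (r : {linear 'rV[R]_n -> M}),
    cancel s r.

Section Frobenius.
Variables (k : fieldType) (K L : hopfType k) (i : hopf_extension K L).

Definition bimodule_map (tr : {linear L -> K}) :=
  forall (a b : K) (l : L), tr (i a * l * i b) = a * tr l * b.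

(* The last clause says that l |-> tr (- * l) is a bijection from L onto the
   left K-linear maps L -> K; for a bimodule map tr it does land there. *)
Definition frobenius_morphism (tr : {linear L -> K}) :=
  bimodule_map tr /\
  forall f : {linear restr i -> (K : nzRingType)^o},
    exists! l : L, forall x : L, f x = tr (x * l).

Definition bicomodule_map (tr : {linear L -> K}) :=
  forall l : L,
    \sw_(l1, l2, l3 <- l) l1 *t (tr l2 *t l3) =
    \sw_(a1, a2, a3 <- tr l) i a1 *t (a2 *t i a3).

Definition frobenius_extension :=
  fg_projective (restr i) /\ exists tr, frobenius_morphism tr.

Definition central_frobenius_extension :=
  frobenius_extension /\
  exists tr, frobenius_morphism tr /\ bicomodule_map tr.

End Frobenius.

(* Main.v *)
From HB Require Import structures.
Require Import Defs.
From mathcomp Require Import all_boot all_order all_algebra all_field.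

(* With (e_i), (e^i) dual bases of H and H^*, the elements
   R(z) = sum_i e^i(S^2((e_i z)_(2))) (e_i z)_(1) are left integrals, and
   sum_j e^j(S(R(e_j)_(2))) R(e_j)_(1) = 1, so one of them is nonzero; call it L.
   By unimodularity L is two-sided, and tr(p (x) a) = p(L) a is H-linear on
   both sides because S^-1(a_(3)) L a_(1) = eps(a_(1)) eps(a_(3)) L.
   For a nonzero right integral the map p |-> p(L_(1)) L_(2) from H^* to H is
   injective, hence bijective; with c_i the preimage of e_i, the families e^i and
   c_i are dual bases for p |-> p(L) on H^*, hence for tr on the double over H.
   For centrality, pair the outer legs with x and y in H: the left-hand side
   evaluates the double at y L x = eps(x) eps(y) L. *)

Set Implicit Arguments.
Unset Strict Implicit.
Unset Printing Implicit Defensive.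

Import GRing.Theory.
Local Open Scope ring_scope.

(** * Linear algebra preliminaries *)

Lemma sum_tlift (k : fieldType) (U V : vectType k) (W : lmodType k) (I : finType)
    (F : I -> U -> V -> W) t :
  \sum_i tlift (F i) t = tlift (fun u v => \sum_i F i u v) t.
Proof.
rewrite /tlift exchange_big; apply: eq_bigr => i _.
by rewrite exchange_big; apply: eq_bigr => j _; rewrite -scaler_sumr.
Qed.

Lemma lin_inj_surj (k : fieldType) (V : vectType k) (f : V -> V) :
  lin f -> (forall v, f v = 0 -> v = 0) -> forall w, exists v, f v = w.
Proof.
move=> fl f0 w.
have fE v : linfun f v = f v by exact: lin_lfunE.
have K : lker (linfun f) == 0%VS.
  by apply/lker0P => u v; rewrite !fE => e; apply/subr0_eq/f0; rewrite -fE linearB /= !fE e subrr.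
have : w \in limg (linfun f).
  rewrite (_ : limg _ = fullv) ?memvf //; apply/eqP.
  have K0 : (fullv :&: lker (linfun f) = 0)%VS by rewrite (eqP K) capv0.
  by rewrite eqEdim subvf (limg_dim_eq K0) leqnn.
by case/memv_imgP => v _ ->; exists v; rewrite fE.
Qed.

(** * Dual bases and integrals of H *)

Section Integrals.
Variables (k : fieldType) (H : hopfType k).
Implicit Types (W : lmodType k) (p q : hdual H) (x y z h L : H).

Lemma dbasis_exp x : \sum_i (dbasis i x : k) *: vb i = x.
Proof. by rewrite [in RHS](vbE x); apply: eq_bigr => i _; rewrite dbasisE. Qed.

(** Both sums express the tensor that corresponds to [T] under H^* (x) H = End(H). *)
Lemma dual_basis_shift W (T : H -> H) (G : hdual H -> H -> W) : lin T -> bilin G ->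
  \sum_i G (dbasis i) (T (vb i)) =
  \sum_i G (linfun (fun y => dbasis i (T y) : k^o)) (vb i).
Proof.
move=> Tl [G2 G1].
transitivity (\sum_i \sum_j (dbasis j (T (vb i)) : k) *: G (dbasis i) (vb j)).
  apply: eq_bigr => i _; rewrite -{1}(dbasis_exp (T (vb i))) (lin_sum _ _ _ (G2 _)).
  by apply: eq_bigr => j _; rewrite (linZ (G2 _)).
rewrite exchange_big; apply: eq_bigr => j _.
rewrite -[linfun _]dual_exp (lin_sum _ _ _ (G1 _)); apply: eq_bigr => i _.
by rewrite (linZ (G1 _)) [linfun _ (vb i)]lin_lfunE //; lin_tac.
Qed.

(** Both sides express the multiplication of H as a tensor in H^* (x) H^* (x) H. *)
Lemma dual_basis_comul W (G : hdual H -> hdual H -> H -> W) :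
  (forall q y, lin (fun p => G p q y)) -> (forall p y, lin (fun q => G p q y)) ->
  (forall p q, lin (G p q)) ->
  \sum_i \sum_j G (dbasis i) (dbasis j) (vb i * vb j) =
  \sum_l tlift (fun p q => G p q (vb l)) (dual_comul (dbasis l)).
Proof.
move=> G1 G2 G3.
transitivity (\sum_i \sum_j \sum_l (dbasis l (vb i * vb j) : k) *: G (dbasis i) (dbasis j) (vb l)).
  do 2!(apply: eq_bigr => ? _); rewrite -{1}(dbasis_exp (_ * _)) (lin_sum _ _ _ (G3 _ _)).
  by apply: eq_bigr => l _; rewrite (linZ (G3 _ _)).
under eq_bigr => i _ do rewrite exchange_big.
rewrite exchange_big; apply: eq_bigr => l _.
have Tl := tlift_lin (fun p q => G p q (vb l)).
rewrite /dual_comul (lin_sum _ _ _ Tl); apply: eq_bigr => i _.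
rewrite (lin_sum _ _ _ Tl); apply: eq_bigr => j _.
by rewrite (linZ Tl) tlift_ten //; lin_tac.
Qed.

(** Its pairing with a functional p is the trace of the endomorphism y |-> p((y z)_(1)) S^2((y
    z)_(2)). *)
Definition trace_integral z : H :=
  \sum_i \sw_(a, b <- vb i * z) (dbasis i (antipode (antipode b)) : k) *: a.

Lemma trace_integral_left z : left_integral (trace_integral z).
Proof.
move=> x; rewrite /trace_integral.
(* [x] is absorbed into [w] at the cost of a factor S(x_(2)), because S(x_(3)) S^2(x_(2)) =
   S(S(x_(2)) x_(3)) collapses to a counit. *)
have step (p : hdual H) w : x * (\sw_(a, b <- w) (p (antipode (antipode b)) : k) *: a) =
    \sw_(x1, x2 <- x) \sw_(a, b <- x1 * w)
      (p (antipode x2 * antipode (antipode b)) : k) *: a.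
  transitivity (\sw_(x1, x2 <- x) \sw_(u, v <- x1) \sw_(c, d <- w)
     (p (antipode (antipode v * x2) * antipode (antipode d)) : k) *: (u * c)).
    rewrite sw_assoc; [|by lin_tac..].
    rewrite -[x in LHS](counitr x) (tlift_comp (g := fun x => x * _)); last by lin_tac.
    apply: tlift_ext => u r.
    rewrite (sw_antipodel (f := fun s => \sw_(c, d <- w)
      (p (antipode s * antipode (antipode d)) : k) *: (u * c))); last by lin_tac.
    rewrite -scalerAl; congr (_ *: _); rewrite (tlift_comp (g := fun x => u * x)); last by lin_tac.
    by apply: tlift_ext => c d; rewrite antipode1 mul1r scalerAr.
  apply: tlift_ext => x1 x2; rewrite sw_mul; last by lin_tac.
  do 2!apply: tlift_ext => ? ?.
  by rewrite !antipodeM mulrA.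
rewrite mulr_sumr; under eq_bigr => i _ do rewrite step.
pose G (x2 : H) (p : hdual H) y := \sw_(a, b <- y * z)
      (p (antipode x2 * antipode (antipode b)) : k) *: a.
have Gb x2 : bilin (G x2).
  have D := @dual_linl k H.
  by split=> [p|y]; rewrite /G; lin_tac.
transitivity (\sw_(x1, x2 <- x) \sum_i G x2 (dbasis i) (x1 * vb i)).
  rewrite sum_tlift; apply: tlift_ext => x1 x2; apply: eq_bigr => i _.
  by rewrite /G !mulrA.
(* Moved from e_i to e^i, the factor x_(1) lands to the left of S(x_(2)), and x_(1) S(x_(2)) =
   eps(x). *)
transitivity (\sw_(x1, x2 <- x) \sum_i \sw_(a, b <- vb i * z)
    (dbasis i (x1 * antipode x2 * antipode (antipode b)) : k) *: a).
  apply: tlift_ext => x1 x2; rewrite dual_basis_shift //; last by lin_tac.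
  apply: eq_bigr => i _; apply: tlift_ext => a b.
  by rewrite lin_lfunE ?mulrA //; lin_tac.
rewrite (sw_antipoder (f := fun s => \sum_i \sw_(a, b <- vb i * z)
    (dbasis i (s * antipode (antipode b)) : k) *: a)); last by lin_tac.
by congr (_ *: _); apply: eq_bigr => i _; apply: tlift_ext => a b; rewrite mul1r.
Qed.

(** With y = e_i e_j, the sum pairs e^i with S^2(y_(3)) and e^j with S(y_(2)). Merging the two dual
    bases into one brings up S^2(y_(3)) S(y_(2)) = S(y_(2) S(y_(3))), which collapses and leaves
    sum_l e^l(1) e_l. *)
Lemma trace_integral_sum :
  \sum_j \sw_(a, b <- trace_integral (vb j)) (dbasis j (antipode b) : k) *: a = 1.
Proof.
have D := @dual_linl k H.
pose G (p q : hdual H) y := \sw_(c, d, b <- y)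
  ((p (antipode (antipode b)) : k) * q (antipode d)) *: c.
have G1 q y : lin (fun p => G p q y) by rewrite /G; lin_tac.
have G2 p y : lin (fun q => G p q y) by rewrite /G; lin_tac.
have G3 p q : lin (G p q) by rewrite /G; lin_tac.
transitivity (\sum_j \sum_i G (dbasis i) (dbasis j) (vb i * vb j)).
  apply: eq_bigr => j _.
  pose F (w : H) := \sw_(a, b <- w) (dbasis j (antipode b) : k) *: a.
  have Fl : lin F by rewrite /F; lin_tac.
  rewrite -/(F _) /trace_integral (lin_sum _ _ _ Fl); apply: eq_bigr => i _.
  rewrite (tlift_comp _ _ Fl) /G -sw_assoc; [|by lin_tac..].
  apply: tlift_ext => a b; rewrite (linZ Fl) /F swZ; apply: tlift_ext => c d.
  by rewrite scalerA.
rewrite exchange_big dual_basis_comul //.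
rewrite -[RHS]dbasis_exp; apply: eq_bigr => l _.
transitivity (\sw_(c, r <- vb l) (counit r : k) *: ((dbasis l 1 : k) *: c)); last first.
  by rewrite (sw_counitr (f := fun c => (dbasis l 1 : k) *: c)) //; lin_tac.
rewrite /G tlift_exch; apply: tlift_ext => c r; rewrite tlift_exch.
rewrite -[in RHS](antipode1 H) -(sw_antipoder (f := fun s => (dbasis l (antipode s) : k) *: c)); last by lin_tac.
apply: tlift_ext => d b; rewrite antipodeM.
by rewrite -dual_comulE (tlift_comp (g := fun s : k^o => (s : k) *: c)) //; lin_tac.
Qed.

Lemma left_integral_exists : exists2 L : H, left_integral L & L != 0.
Proof.
case: (pickP (fun j => trace_integral (vb j) != 0)) => [j nz|z].
  by exists (trace_integral (vb j)); first exact: trace_integral_left.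
have := trace_integral_sum; rewrite big1 => [/eqP|j _].
  by rewrite eq_sym oner_eq0.
by move/negbFE/eqP: (z j) => ->; rewrite linear0 (lin0 (tlift_lin _)).
Qed.

(** Insert y_(2) S(y_(3)) in the second leg and use Delta(L y_(1)) = eps(y_(1)) Delta(L). *)
Lemma right_integral_shift W (f : H -> H -> W) L y : right_integral L -> bilin f ->
  \sw_(a, b <- L) f (a * y) b = \sw_(a, b <- L) f a (b * antipode y).
Proof.
move=> Lr [f1 f2].
transitivity (\sw_(y1, y2 <- y) \sw_(a, b <- L * y1) f a (b * antipode y2)); last first.
  rewrite -[RHS](sw_counitl (f := fun y => \sw_(a, b <- L) f a (b * antipode y))); last by lin_tac.
  by apply: tlift_ext => y1 y2; rewrite Lr linearZ (linZ (tlift_lin _)).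
transitivity (\sw_(a, b <- L) \sw_(r, z <- y) \sw_(c, d <- r) f (a * c) (b * (d * antipode z))).
  apply: tlift_ext => a b; rewrite sw_assoc; [|by lin_tac..].
  rewrite -[LHS](sw_counitr (f := fun y => f (a * y) b)); last by lin_tac.
  apply: tlift_ext => c r.
  by rewrite (sw_antipoder (f := fun s => f (a * c) (b * s))) ?mulr1 //; lin_tac.
rewrite tlift_exch; apply: tlift_ext => r z; rewrite sw_mul; last by lin_tac.
by do 2!apply: tlift_ext => ? ?; rewrite mulrA.
Qed.

(** * Contraction of functionals with a right integral *)

Definition contract L p : H := \sw_(a, b <- L) (p a : k) *: b.

Lemma contract_lin L : lin (contract L).
Proof. have D := @dual_linl k H; rewrite /contract; by lin_tac. Qed.

(** By the shift, p(L_(1) z) L_(2) = p(L_(1)) L_(2) S(z) = 0 for all z. Letting z be S(L_(2)) y,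
    with the last leg becoming L_(3), turns this into p(y) L = 0. *)
Lemma contract_eq0 L p : right_integral L -> L != 0 -> contract L p = 0 -> p = 0.
Proof.
move=> Lr nz c0; apply/lfunP => y; rewrite zero_lfunE.
suff /eqP : (p y : k) *: L = 0 by rewrite scaler_eq0 (negPf nz) orbF => /eqP.
have shift0 z : \sw_(a, b <- L) (p (a * z) : k) *: b = 0.
  rewrite (right_integral_shift (f := fun a b => (p a : k) *: b)) //; last by lin_tac.
  rewrite -[RHS](mul0r (antipode z)) -c0 (tlift_comp (g := fun b => b * _)); last by lin_tac.
  by apply: tlift_ext => a b; rewrite scalerAl.
(* [F] makes it legitimate for z to depend on L: S(L_(2)) is expanded in the basis e_i, and
   [F (dbasis i)] supplies its coefficients. *)
pose F (q : hdual H) w := \sw_(b, c <- w) (q (antipode b) : k) *: c.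
have Fl q : lin (F q) by rewrite /F; lin_tac.
transitivity (\sum_i F (dbasis i) (\sw_(a, b <- L) (p (a * (vb i * y)) : k) *: b)); last first.
  by rewrite big1 // => i _; rewrite shift0 (lin0 (Fl _)).
transitivity (\sw_(a, b, c <- L) (p (a * (antipode b * y)) : k) *: c).
  rewrite -sw_assoc; [|by lin_tac..].
  rewrite -[L in LHS]counitl swZ; apply: tlift_ext => r c.
  under tlift_ext => a b do rewrite mulrA.
  rewrite (sw_antipoder (f := fun s => (p (s * y) : k) *: c)); last by lin_tac.
  by rewrite mul1r !scalerA mulrC.
rewrite [LHS](_ : _ = \sum_i \sw_(a, b, c <- L)
    (p (a * (vb i * y)) * (dbasis i (antipode b)) : k) *: c).
  apply: eq_bigr => i _; rewrite (tlift_comp _ _ (Fl _)); apply: tlift_ext => a r.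
  rewrite (linZ (Fl _)) /F swZ; apply: tlift_ext => b c.
  by rewrite scalerA.
rewrite sum_tlift; apply: tlift_ext => a r; rewrite sum_tlift; apply: tlift_ext => b c.
rewrite -scaler_suml -{1}[antipode _]dbasis_exp mulr_suml mulr_sumr linear_sum.
congr (_ *: _); apply: eq_bigr => l _.
by rewrite -scalerAl -scalerAr linearZ /= [_ *: _]mulrC.
Qed.

Lemma contract_surj L : right_integral L -> L != 0 -> forall x, exists p, contract L p = x.
Proof.
move=> Lr nz x.
(* [D] sends e_i to e^i and so identifies H with H^*; composing with it gives an injective
   endomorphism of H. *)
pose D y : hdual H := \sum_i (dbasis i y : k) *: dbasis i.
have Dl : lin D by apply: lin_big => i; lin_tac.
have D0 y : D y = 0 -> y = 0.
  move=> D0; rewrite -[y]dbasis_exp big1 // => i _.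
  have := congr1 (fun p : hdual H => p (vb i)) D0; rewrite sum_lfunE zero_lfunE.
  rewrite (bigD1 i) //= big1 ?addr0 => [|j nj]; rewrite scale_lfunE !dbasisE v2r_vb.
    by rewrite eqxx /GRing.scale /= mulr1 => ->; exact: scale0r.
  by rewrite (negPf nj) /GRing.scale /= mulr0.
have [y <-] := lin_inj_surj (lin_comp (contract_lin L) Dl)
  (fun y e => D0 y (contract_eq0 Lr nz e)) x.
by exists (D y).
Qed.

Lemma contractE L p q : q (contract L p) = conv p q L.
Proof.
rewrite convE tlift_comp; last by lin_tac.
by apply: tlift_ext => a b; rewrite linearZ.
Qed.

End Integrals.

(** * Linearity of the trace [ev L] on the double *)

Section Drin.
Variables (k : fieldType) (H : hopfType k).
Implicit Types (p q : hdual H) (x a b L : H) (l m : drin H).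

HB.instance Definition _ x := GRing.isLinear.Build k (drin H) H _ (@ev k H x) (@ev_lin k H x).

Lemma ev_integral_incl L a l : left_integral L -> right_integral L ->
  ev L (drin_incl a * l) = a * ev L l.
Proof.
move=> Ll Lr; have E := ev_linx; rewrite ev_drin_incl /rsw.
transitivity (\sw_(a1, a2, a3 <- a) (counit a1 : k) *: ((counit a3 : k) *: (a2 * ev L l))).
  apply: tlift_ext => a1 r; apply: tlift_ext => a2 a3.
  rewrite Ll -scalerAl Lr counit_antipodeV !(linZ (E _ _ _)) -!scalerAr.
  by rewrite scalerA mulrC -scalerA.
under tlift_ext => a1 r do rewrite -swZ.
rewrite (sw_counitl (f := fun r => \sw_(a2, a3 <- r) (counit a3 : k) *: (a2 * ev L l))); last by lin_tac.
by rewrite (sw_counitr (f := fun a2 => a2 * ev L l)) //; lin_tac.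
Qed.

(** No integral is involved: right multiplication by [drin_incl b] affects only the H-factor. *)
Lemma ev_mul_incl x l b : ev x (l * drin_incl b) = ev x l * b.
Proof.
have E := ev_lin.
rewrite -[l * _]/(drin_mul _ _) ev_mul -[in RHS](sw_counitr (f := fun x => ev x l * b) x); last first.
  have EX := ev_linx; by lin_tac.
apply: tlift_ext => x1 x2.
rewrite -(rsw_counity (f := fun c => c * b)); last by lin_tac.
by apply: rsw_ext => y c; rewrite ev_ten dual_oneE scalerAr.
Qed.

(* The bijective antipode maps p (x) a to S(a) (p o S^-1), so the products a p
   span the double. *)
Lemma drin_ext_incl_dual (W : lmodType k) (f g : drin H -> W) : lin f -> lin g ->
  (forall a p, f (drin_incl a * drin_dual p) = g (drin_incl a * drin_dual p)) -> f =1 g.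
Proof.
move=> fl gl e l; rewrite -[l](antipodeVK (s := drin H)).
move: (antipodeV l) => m; tens_ind m => p a.
by rewrite -[antipode _]/(drin_antipode _) drin_antipode_ten.
Qed.

Lemma ev_drin_dual_conv L p q : ev L (drin_dual p * drin_dual q) = (q (contract L p) : k)%:A.
Proof. by rewrite -drin_dualM ev_ten contractE. Qed.

(** * Dual bases for the trace, and the Frobenius and bicomodule properties *)

Section DualBases.
Variables (L : H) (c : 'I_(dim H) -> hdual H).
Hypotheses (Ll : left_integral L) (Lr : right_integral L) (L0 : L != 0).
Hypothesis cE : forall i, contract L (c i) = vb i.

(** Contraction with [L] is injective and sends both sides to the same element, since it maps c_i to
    e_i. *)
Lemma dbasis_contract p : \sum_i (dbasis i (contract L p) : k) *: c i = p.
Proof.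
have Cl := contract_lin L.
apply/subr0_eq/(contract_eq0 Lr L0).
rewrite -scaleN1r addrC Cl (lin_sum _ _ _ Cl) -[contract L p in X in X + _]dbasis_exp.
rewrite scaleN1r addrC; apply/eqP; rewrite subr_eq0; apply/eqP.
by apply: eq_bigr => i _; rewrite (linZ Cl) cE.
Qed.

(** On products a p the factor a comes out by left H-linearity of the trace, and [dbasis_contract]
    remains. *)
Lemma drin_dual_basisl l :
  \sum_i drin_incl (ev L (l * drin_dual (dbasis i))) * drin_dual (c i) = l.
Proof.
have E := ev_lin L; have I := @drin_incl_lin k H; have D := @drin_dual_lin k H.
move: l; apply: drin_ext_incl_dual => //; first by lin_tac.
move=> a p; rewrite -[in RHS](dbasis_contract p) (lin_sum _ _ _ D) mulr_sumr.
apply: eq_bigr => i _; rewrite -mulrA ev_integral_incl // ev_drin_dual_conv.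
by rewrite -scalerAr mulr1 (linZ I) (linZ D) -scalerAl -scalerAr.
Qed.

Lemma drin_dual_basisr l :
  \sum_i drin_dual (dbasis i) * drin_incl (ev L (drin_dual (c i) * l)) = l.
Proof.
have E := ev_lin L; have I := @drin_incl_lin k H; have D := @drin_dual_lin k H.
tens_ind l => p a; rewrite -drin_dual_incl -{2}[p]dual_exp (lin_sum _ _ _ D) mulr_suml.
apply: eq_bigr => i _; rewrite mulrA ev_mul_incl ev_drin_dual_conv cE.
by rewrite -scalerAl mul1r (linZ I) (linZ D) -scalerAl -scalerAr.
Qed.

Lemma drin_fg_projective : fg_projective (restr (drin_extension H)).
Proof.
exists (dim H).
pose s (l : restr (drin_extension H)) : 'rV[H]_(dim H) :=
  \row_i ev L ((l : drin H) * drin_dual (dbasis i)).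
pose r (v : 'rV[H]_(dim H)) : restr (drin_extension H) :=
  \sum_i drin_incl (v 0 i) * drin_dual (c i).
have sl : linear s.
  move=> a l m; apply/rowP => i; rewrite !mxE.
  rewrite -[a *: l + m]/(drin_incl a * (l : drin H) + (m : drin H)).
  by rewrite mulrDl -mulrA linearD /= ev_integral_incl.
have rl : linear r.
  move=> a u v; rewrite /r scaler_sumr -big_split; apply: eq_bigr => i _.
  rewrite !mxE linearD /= drin_inclM mulrDl.
  by rewrite -[a *: _]/(drin_incl a * _) mulrA.
exists (HB.pack_for {linear restr (drin_extension H) -> 'rV[H]_(dim H)} s
   (GRing.isLinear.Build _ _ _ _ s sl)).
exists (HB.pack_for {linear 'rV[H]_(dim H) -> restr (drin_extension H)} r
   (GRing.isLinear.Build _ _ _ _ r rl)).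
move=> l /=; rewrite /r -[RHS](drin_dual_basisl l).
by apply: eq_bigr => i _; rewrite mxE.
Qed.

Lemma drin_frobenius_morphism :
  frobenius_morphism (drin_extension H) (ev L : {linear drin H -> H}).
Proof.
split=> [a b l|f].
  by rewrite /= ev_mul_incl ev_integral_incl.
have fE (l : restr (drin_extension H)) :
    f l = \sum_i ev L ((l : drin H) * drin_dual (dbasis i)) * f (drin_dual (c i)).
  rewrite -[l in LHS](drin_dual_basisl l) linear_sum; apply: eq_bigr => i _.
  exact: (linearZ_LR f).
(* The witness is forced: f(c_i) must be tr(c_i l), and [drin_dual_basisr] recovers l from these
   values. *)
exists (\sum_i drin_dual (dbasis i) * drin_incl (f (drin_dual (c i)))); split.
  move=> x; rewrite fE mulr_sumr linear_sum; apply: eq_bigr => i _.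
  by rewrite mulrA /= ev_mul_incl.
move=> l lE; rewrite -[RHS]drin_dual_basisr; apply: eq_bigr => i _.
by rewrite lE.
Qed.

Lemma drin_bicomodule_map :
  bicomodule_map (drin_extension H) (ev L : {linear drin H -> H}).
Proof.
move=> l; have E := @ev_lin k H; have EX := @ev_linx k H.
(* The middle leg already lies in H, so the identity alone separates it. *)
have id_sep : sepfam (fun (_ : unit) (a : H) => a).
  split=> [//|]; exists unit, id, (fun _ a => a); split=> // a.
  by rewrite big_const cardT enumT unlock /= addr0.
apply: (sep_inj (sep_tens (@ev_sep k H) (sep_tens id_sep (@ev_sep k H)))) => -[x [_ y]] /=.
set T := tmap _ _; have Tl : lin T by exact: tlift_lin.
have TE l1 h l3 : T (l1 *t (h *t l3)) = ev x l1 *t (h *t ev y l3).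
  by rewrite /T /tmap !tlift_ten //; lin_tac.
(* On the right-hand side the outer legs are eps (x) a, so pairing them with [x] and [y] only yields
   counits. *)
transitivity ((counit x * counit y : k) *: \sw_(a, r <- ev L l) a *t comul r); last first.
  rewrite swZ (tlift_comp _ _ Tl); apply: tlift_ext => a1 r.
  rewrite -[comul r in LHS]tlift_tenE (tlift_comp (g := ten a1)); last by lin_tac.
  rewrite swZ (tlift_comp _ _ Tl); apply: tlift_ext => a2 a3.
  rewrite TE !ev_ten !dual_oneE (linZ (ten_linl _)) !(linZ (ten_linr _)).
  by rewrite scalerA.
transitivity (\sw_(l1, r <- l) ev x l1 *t ((counit y : k) *: comul (ev L r))).
  rewrite (tlift_comp _ _ Tl); apply: tlift_ext => l1 r.
  (* The co-opposite coproduct reverses the order: pairing the last two legs with L and y evaluates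
     at y L, and below, pairing with x and L evaluates at L x. *)
  rewrite -linearZ /= -(linZ (EX _)) -Ll -[_ * L]/((L, y).2 * (L, y).1) -ev2_comul.
  rewrite -[drin_comul r in RHS]tlift_tenE (tlift_comp _ _ (ev2_lin _)).
  rewrite (tlift_comp _ _ Tl) (tlift_comp (g := ten (ev x l1))); last by lin_tac.
  by apply: tlift_ext => l2 l3; rewrite TE ev2_ten.
pose F := tlift (fun a r : H => a *t comul r).
have Fl : lin F by exact: tlift_lin.
rewrite mulrC -scalerA -/(F (comul _)) -(linZ Fl) -[_ *: comul _]linearZ /= -(linZ (EX _)) -Lr.
rewrite -[L * x]/((x, L).2 * (x, L).1) -ev2_comul.
rewrite -[drin_comul l in RHS]tlift_tenE (tlift_comp _ _ (ev2_lin _)) (tlift_comp _ _ Fl) swZ.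
apply: tlift_ext => l1 l2; rewrite ev2_ten /F tlift_ten; last by lin_tac.
by rewrite (linZ (ten_linr _)).
Qed.
End DualBases.

End Drin.

Theorem corollary5p1 (k : fieldType) (H : hopfType k) (uniH : unimodular H) :
  central_frobenius_extension (drin_extension H).
Proof.
have [L Ll L0] := left_integral_exists H.
have Lr : right_integral L by apply/uniH.
have [c cE] := fin_all_exists (fun i => contract_surj Lr L0 (vb i)).
have Fr := drin_frobenius_morphism Ll Lr L0 cE.
split; first by split; [exact: drin_fg_projective cE | exists (ev L)].
by exists (ev L); split=> //; exact: drin_bicomodule_map.
Qed.
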